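(* Assume the following condition (A) on data generating processes, where $V$ is a covariate taking values in a set $\mathbf V$: (i) for each $t^\ast\in\{0,1\}$, $Z$ is conditionally independent of $(T_{t^\ast},Y_{t^\ast},T^\ast_0,T^\ast_1)$ given $V$; (ii) $T^\ast_1\ge T^\ast_0$ almost surely; (iii) $0<P(Z=1\mid V)<1$. Let $P$ be an arbitrary distribution of the observed variables $(Y,T,Z,V)$. Then the sharp identified set $\Theta_I(P)$ for the local average treatment effect is as follows: $\Theta_I(P)=\Theta$ if $E_P[TV_{(Y,T)\mid V}]=0$; otherwise $$ \Theta_I(P)=\begin{cases} \left[E_P[\Delta E_P[Y\mid Z,V]],\ \dfrac{E_P[\Delta E_P[Y\mid Z,V]]}{E_P[TV_{(Y,T)\mid V}]}\right] & \text{if }E_P[\Delta E_P[Y\mid Z,V]]>0,\\ \{0\} & \text{if }E_P[\Delta E_P[Y\mid Z,V]]=0,\\ \left[\dfrac{E_P[\Delta E_P[Y\mid Z,V]]}{E_P[TV_{(Y,T)\mid V}]},\ E_P[\Delta E_P[Y\mid Z,V]]\right] & \text{if }E_P[\Delta E_P[Y\mid Z,V]]<0. \end{cases} $$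
   Context: Variables. $Z\in\{0,1\}$ is a binary instrument; $T^\ast_z\in\{0,1\}$ ($z=0,1$) is the counterfactual true treatment when $Z=z$; $Y_{t^\ast}$ (real-valued) and $T_{t^\ast}\in\{0,1\}$ ($t^\ast=0,1$) are the counterfactual outcome and the counterfactual measured treatment when the true treatment equals $t^\ast$; $V$ is an observed covariate. Outcomes have distributions dominated by a known finite measure $\mu_Y$ on the real line. The (unobserved) true treatment is $T^\ast=T^\ast_Z$; the observed variables are $(Y,T,Z,V)$ with $Y=Y_{T^\ast}$ and $T=T_{T^\ast}$. A data generating process $P^\ast$ is a joint distribution of $(Y_0,Y_1,T_0,T_1,T^\ast_0,T^\ast_1,Z,V)$; $P^\ast_{(Y,T,Z,V)}$ denotes the distribution of $(Y,T,Z,V)$ it induces. $\mathcal P^\ast$ is the set of all $P^\ast$ satisfying condition (A) of the claim. The distribution $P$ of $(Y,T,Z,V)$ satisfies $0<P(Z=1\mid V)<1$, $Y$ is dominated by $\mu_Y$, and $E_P[E_P[|Y|\mid Z=z,V]]<\infty$ for $z=0,1$. The local average treatment effect is $\theta(P^\ast)=E_{P^\ast}[Y_1-Y_0\mid T^\ast_0<T^\ast_1]$. The parameter space $\Theta$ is the set of all numbers $\int y f_1(y)\,d\mu_Y(y)-\int y f_0(y)\,d\mu_Y(y)$ where $f_0,f_1$ are probability densities with respect to $\mu_Y$ (with finite first moments). The sharp identified set is $$\Theta_I(P)=\{\theta(P^\ast)\in\Theta:\ P^\ast\in\mathcal P^\ast,\ P^\ast_{(Y,T,Z,V)}=P\}.$$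 Convention: if $P^\ast(T^\ast_0<T^\ast_1)=0$, the conditional laws of $Y_1$ and $Y_0$ given the null event $\{T^\ast_0<T^\ast_1\}$ may be specified arbitrarily (with $\mu_Y$-densities), so that $\theta(P^\ast)$ is then allowed to be any element of $\Theta$. Notation: $\Delta E_P[X\mid Z,V]=E_P[X\mid Z=1,V]-E_P[X\mid Z=0,V]$, a random variable that is a function of $V$. For $X$ with dominating measure $\mu_X$ and conditional densities $f_{X\mid Z=z,V}$, $TV_{X\mid V}=\frac12\int|f_{X\mid Z=1,V}(x)-f_{X\mid Z=0,V}(x)|\,d\mu_X(x)$, also a function of $V$ (for $X=(Y,T)$, $\mu_X$ is the product of $\mu_Y$ and counting measure on $\{0,1\}$). *)

(* Defs.v *)
From HB Require Import structures.
From mathcomp Require Import all_boot all_order all_algebra.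
From mathcomp Require Import all_classical all_reals all_analysis.
From mathcomp Require Import measurable_realfun.

Set Implicit Arguments.
Unset Strict Implicit.
Unset Printing Implicit Defensive.

Import Order.TTheory GRing.Theory Num.Theory.
Local Open Scope classical_set_scope.
Local Open Scope ring_scope.

(* Counting measure on {0,1}. The alias carries the finiteness instance, which
   the library declares for [counting] on nat only and which [\x] requires. *)
Definition counting_bool (R : realType) : set bool -> \bar R := @counting bool R.

HB.instance Definition _ (R : realType) := Measure.on (@counting_bool R).

Lemma counting_bool_fin_num_fun (R : realType) :
  fin_num_fun (@counting_bool R).
Proof.
move=> A _; rewrite /counting_bool /counting asboolT //.
exact: finite_finset.
Qed.

HB.instance Definition _ (R : realType) :=
  Measure_isFinite.Build _ _ _ (@counting_bool R)
    (@counting_bool_fin_num_fun R).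

Section Conditioning.
Context {d d' : measure_display} {Omega : measurableType d}
  {U : measurableType d'} {R : realType}.
Variables (P : probability Omega R) (W : Omega -> U).

(* [h \o W] is a version of E_P[X | W], for X integrable or nonnegative. *)
Definition is_cond_exp (X : Omega -> \bar R) (h : U -> \bar R) : Prop :=
  measurable_fun setT h /\
  forall B : set U, measurable B ->
    (\int[P]_(w in W @^-1` B) h (W w) = \int[P]_(w in W @^-1` B) X w)%E.

(* u |-> E_P[X | W = u], as a function on the range of W; it is determined up
   to a null set of the law of W. *)
Definition cond_exp (X : Omega -> \bar R) : U -> \bar R :=
  xget (cst 0%E) [set h | is_cond_exp X h].

Definition cond_prob (A : set Omega) : U -> \bar R :=
  cond_exp (fun w => (\1_A w)%:E).

Definition cond_indep {d1 d2 : measure_display} {S1 : measurableType d1}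
    {S2 : measurableType d2} (X1 : Omega -> S1) (X2 : Omega -> S2) : Prop :=
  forall (A : set S1) (B : set S2), measurable A -> measurable B ->
    {ae P, forall w,
      cond_prob (X1 @^-1` A `&` X2 @^-1` B) (W w) =
      (cond_prob (X1 @^-1` A) (W w) * cond_prob (X2 @^-1` B) (W w))%E}.

(* [fun x => f (x, u)] is the density f_{X | W = u} with respect to mu. *)
Definition is_cond_density {dx : measure_display} {S : measurableType dx}
    (mu : set S -> \bar R) (X : Omega -> S) (f : S * U -> R) : Prop :=
  [/\ measurable_fun setT f, forall z, 0 <= f z &
    forall (A : set S) (B : set U), measurable A -> measurable B ->
      P (X @^-1` A `&` W @^-1` B) =
      (\int[P]_(w in W @^-1` B) \int[mu]_(x in A) (f (x, W w))%:E)%E].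

Definition cond_density {dx : measure_display} {S : measurableType dx}
    (mu : set S -> \bar R) (X : Omega -> S) : S * U -> R :=
  xget (cst 0) [set f | is_cond_density mu X f].

(* The conditional laws of X given W are dominated by mu: the law of (X, W) is
   dominated by the product of mu and the law of W, whose null sets N are those
   with mu-null section at W, almost surely. *)
Definition cond_dominated {dx : measure_display} {S : measurableType dx}
    (mu : set S -> \bar R) (X : Omega -> S) : Prop :=
  forall N : set (S * U), measurable N ->
    {ae P, forall w, mu [set x | N (x, W w)] = 0%E} ->
    P [set w | N (X w, W w)] = 0%E.

End Conditioning.

(* A point of the observed space is ((Y, T, Z), V). Binary variables are bool,
   with false for 0 and true for 1. *)
Notation obs V R := (R * bool * bool * V)%type.

Section Observed.
Context {dV : measure_display} {V : measurableType dV} {R : realType}.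

Definition obsY (o : obs V R) : R := o.1.1.1.
Definition obsYT (o : obs V R) : R * bool := o.1.1.
Definition obsZ (o : obs V R) : bool := o.1.2.
Definition obsV (o : obs V R) : V := o.2.
Definition obsZV (o : obs V R) : bool * V := (obsZ o, obsV o).

End Observed.

Section ObservedLaw.
Context {dV : measure_display} {V : measurableType dV} {R : realType}.
Variables (muY : {finite_measure set R -> \bar R})
  (P : probability (obs V R) R).

(* z v |-> E_P[Y | Z = z, V = v] *)
Definition EY (z : bool) (v : V) : \bar R :=
  cond_exp P obsZV (fun o => (obsY o)%:E) (z, v).

Definition EabsY (z : bool) (v : V) : \bar R :=
  cond_exp P obsZV (fun o => `|(obsY o)%:E|%E) (z, v).

Definition DeltaEY (v : V) : R := fine (EY true v) - fine (EY false v).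

Definition muYT : set (R * bool) -> \bar R := (muY \x @counting_bool R)%E.

HB.instance Definition _ := Measure.on muYT.

Definition fYT (z : bool) (v : V) (x : R * bool) : R :=
  cond_density P obsZV muYT obsYT (x, (z, v)).

Definition TV_YT (v : V) : R :=
  2^-1 * \int[muYT]_x `|fYT true v x - fYT false v x|.

Definition overlap {d : measure_display} {Omega : measurableType d}
    (Q : probability Omega R) (Z : Omega -> bool) (X : Omega -> V) : Prop :=
  {ae Q, forall w, (0 < cond_prob Q X (Z @^-1` [set true]) (X w) < 1)%E}.

(* Conditional domination given V is what makes the conditional densities
   f_{Y,T | Z = z, V} exist. *)
Definition admissible_law : Prop :=
  [/\ overlap P obsZ obsV,
      cond_dominated P obsV muY obsY &
      forall z : bool, (\int[P]_o EabsY z (obsV o) < +oo)%E].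

Definition mean_DeltaEY : R := \int[P]_o DeltaEY (obsV o).

Definition mean_TV_YT : R := \int[P]_o TV_YT (obsV o).

End ObservedLaw.

(* A point of the latent space is
   ((((Y_0, Y_1), (T_0, T_1)), (T*_0, T*_1)), Z), V). *)
Notation latent V R :=
  ((R * R) * (bool * bool) * (bool * bool) * bool * V)%type.

Section Latent.
Context {dV : measure_display} {V : measurableType dV} {R : realType}.

Definition at_ {A : Type} (t : bool) (p : A * A) : A := if t then p.2 else p.1.

Definition latY (t : bool) (w : latent V R) : R := at_ t w.1.1.1.1.
Definition latT (t : bool) (w : latent V R) : bool := at_ t w.1.1.1.2.
Definition latTstar (z : bool) (w : latent V R) : bool := at_ z w.1.1.2.
Definition latZ (w : latent V R) : bool := w.1.2.
Definition latV (w : latent V R) : V := w.2.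

Definition observe (w : latent V R) : obs V R :=
  let tstar := latTstar (latZ w) w in
  (latY tstar w, latT tstar w, latZ w, latV w).

Definition compliers : set (latent V R) :=
  [set w | (latTstar false w < latTstar true w)%N].

End Latent.

Section Identification.
Context {dV : measure_display} {V : measurableType dV} {R : realType}.
Variable muY : {finite_measure set R -> \bar R}.

Definition condition_A (Q : probability (latent V R) R) : Prop :=
  [/\ forall t : bool,
        cond_indep Q latV latZ
          (fun w => (latT t w, latY t w, latTstar false w, latTstar true w)),
      {ae Q, forall w, (latTstar false w <= latTstar true w)%N} &
      overlap Q latZ latV].

Definition outcomes_dominated (Q : probability (latent V R) R) : Prop :=
  forall t : bool, pushforward Q (latY t) `<< muY.

Definition induces (Q : probability (latent V R) R)
    (P : probability (obs V R) R) : Prop :=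
  forall A : set (obs V R), measurable A -> Q (observe @^-1` A) = P A.

Definition is_density (f : R -> R) : Prop :=
  [/\ measurable_fun setT f, forall y, 0 <= f y,
      (\int[muY]_y (f y)%:E = 1)%E &
      muY.-integrable setT (fun y => (y * f y)%:E)].

Definition Theta : set R :=
  [set theta | exists f0 f1 : R -> R, [/\ is_density f0, is_density f1 &
     theta = \int[muY]_y (y * f1 y) - \int[muY]_y (y * f0 y)]].

(* The values of E_Q[Y_1 - Y_0 | compliers]: every element of Theta if the
   compliers are a null set. The first equation is between extended reals, so
   that it forces the integral to be finite. *)
Definition LATE (Q : probability (latent V R) R) : set R :=
  [set theta |
    (Q compliers != 0%E /\
     theta%:E = ((fine (Q compliers))^-1%:E *
       \int[Q]_(w in compliers) (latY true w - latY false w)%:E)%E)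
    \/ (Q compliers = 0%E /\ Theta theta)].

Definition ThetaI (P : probability (obs V R) R) : set R :=
  [set theta | Theta theta /\
    exists Q : probability (latent V R) R,
      [/\ condition_A Q, outcomes_dominated Q, induces Q P & LATE Q theta]].

End Identification.

(* Main.v *)
Require Import Defs.
From HB Require Import structures.
From mathcomp Require Import all_boot all_order all_algebra.
From mathcomp Require Import all_classical all_reals all_analysis.
From mathcomp Require Import measurable_realfun ring lra.

(** Write S for the pair (Y, T), q_z for its conditional density given Z = z
    and V, and p for the propensity P(Z = 1 | V).

    The bounds come from one identity. Let a latent law satisfy condition (A)
    and induce P. Weighting the event Z = z by the inverse of its propensity
    turns the observed law of (S, V) into the law with density q_z given V
    ([arm_mean_weighting]); on the latent side the same weighting removes Z,
    which is independent of the variables of each arm given V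
    ([cond_indep_resample]). Hence q_z is the density of S_1 on the takers under
    z plus that of S_0 on the others ([arm_mean_latent]), and by monotonicity
    q_1 - q_0 is the difference between the subdensities of S_1 and S_0 on the
    compliers ([complier_identity]). Integrating the outcome, the effect times
    the mass c of the compliers is E[Delta E[Y | Z, V]] ([complier_effect]).
    Integrating the indicator of {q_0 < q_1} shows that c is at least the mean
    total variation ([compliers_lower_bound]). The effect is therefore
    E[Delta E[Y | Z, V]] / c with c between E[TV] and 1.

    Conversely every such c occurs ([realization]). Fix lam in [0, 1] and let
    r = lam min(q_0, q_1). Given V, a never-taker has S_0 and S_1 with
    subdensity r, a complier has S_t with subdensity q_t - r, and Z is drawn
    independently. The subdensities of S_0 and S_1 within a type have the same
    mass, so they can be coupled ([coupling]); condition (A) only concerns the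
    arms one at a time, so the product coupling will do. The arm z is then
    (q_z - r) + r = q_z, as it should be. Since the integral of min(q_0, q_1) is
    1 - TV, the compliers have mass 1 - lam (1 - E[TV]), which ranges over
    [E[TV], 1]. The resulting effect lies in the parameter space because the law
    of an outcome among the compliers is dominated, so that it has a density
    ([complier_density]).

    What remains is to give the conditional expectations and densities, which
    are versions chosen arbitrarily, their usual meaning. Domination gives a
    conditional density by the Radon-Nikodym theorem ([cond_density_exists]);
    all other versions are integrals against it ([cond_exp_density]), almost
    everywhere unique. Most identities between laws are stated as equalities of
    integrals of nonnegative functions, which follow from their case of
    indicators of sets or rectangles ([weighted_law_ext],
    [weighted_law_ext_prod]). *)

Set Implicit Arguments.
Unset Strict Implicit.
Unset Printing Implicit Defensive.

Import Order.TTheory GRing.Theory Num.Theory.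
Local Open Scope classical_set_scope.
Local Open Scope ring_scope.

(** * Weighted measures and their images *)

Lemma measurable_preimage {d d'} {T : measurableType d} {U : measurableType d'}
    (f : T -> U) (B : set U) :
  measurable_fun setT f -> measurable B -> measurable (f @^-1` B).
Proof. by move=> mf mB; rewrite -[X in measurable X]setTI; exact: mf. Qed.

Lemma ae_and {d} {T : measurableType d} {R : realType}
    (mu : {measure set T -> \bar R}) (p1 p2 : T -> Prop) :
  {ae mu, forall x, p1 x} -> {ae mu, forall x, p2 x} ->
  {ae mu, forall x, p1 x /\ p2 x}.
Proof. exact: filterI. Qed.

Lemma measure_integral_indic {d} {T : measurableType d} {R : realType}
    (mu : {measure set T -> \bar R}) (B : set T) :
  measurable B -> (mu B = \int[mu]_u (\1_B u)%:E)%E.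
Proof. by move=> mB; rewrite integral_indic// setIT. Qed.

Lemma measurable_indicE {d} {T : measurableType d} {R : realType} (B : set T) :
  measurable B -> measurable_fun setT (fun u => (\1_B u)%:E : \bar R).
Proof. by move=> mB; exact/measurable_EFinP. Qed.

Lemma indicE_ge0 {T} {R : realType} (A : set T) x : (0 <= (\1_A x)%:E :> \bar R)%E.
Proof. by rewrite lee_fin. Qed.

Section Weighted.
Local Open Scope ereal_scope.
Context {d : measure_display} {T : measurableType d} {R : realType}.

Section density.
Variables (mu : {sigma_finite_measure set T -> \bar R}) (f : T -> \bar R).
Hypotheses (mf : measurable_fun setT f) (f0 : forall x, 0 <= f x)
  (foo : \int[mu]_x f x < +oo).

Let dm (A : set T) := \int[mu]_(x in A) f x.

Let dm0 : dm set0 = 0.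
Proof. exact: integral_set0. Qed.

Let dm_ge0 A : 0 <= dm A.
Proof. exact: integral_ge0. Qed.

Let dm_sigma_additive : semi_sigma_additive dm.
Proof.
move=> F mF tF mUF; rewrite [X in _ --> X](_ : _ = \sum_(n <oo) dm (F n)).
  by apply: is_cvg_nneseries => n _ _; exact: dm_ge0.
by apply: ge0_integral_bigcup => //; exact: measurable_funTS.
Qed.

HB.instance Definition _ := isMeasure.Build _ _ _ dm dm0 dm_ge0 dm_sigma_additive.

Let dm_fin : fin_num_fun dm.
Proof.
move=> A mA; rewrite ge0_fin_numE//; apply: le_lt_trans foo.
exact: ge0_subset_integral.
Qed.

HB.instance Definition _ := Measure_isFinite.Build _ _ _ dm dm_fin.

(** The Radon-Nikodym theorem gives the change of variables for its own
    derivative, which is [f] almost everywhere. *)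
Lemma finite_density_measure : exists nu : {finite_measure set T -> \bar R},
  forall F : T -> \bar R, measurable_fun setT F -> (forall x, 0 <= F x) ->
    \int[nu]_x F x = \int[mu]_x (F x * f x).
Proof.
exists dm => F mF F0.
have dom : dm `<< mu.
  apply/null_content_dominatesP => A mA muA0.
  by apply: null_set_integral => //; exact: measurable_funTS.
have := Radon_Nikodym_SigmaFinite.change_of_variables dom F0 measurableT mF.
move=> <-; apply: ge0_ae_eq_integral => //.
- apply: emeasurable_funM => //.
  exact: measurable_int (Radon_Nikodym_SigmaFinite.f_integrable _).
- exact: emeasurable_funM.
- by move=> x _; rewrite mule_ge0// Radon_Nikodym_SigmaFinite.f_ge0.
- by move=> x _; rewrite mule_ge0.
apply: ae_eqe_mul2l; apply: integral_ae_eq => //.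
- exact: Radon_Nikodym_SigmaFinite.f_integrable.
- by move=> E _ mE; rewrite -Radon_Nikodym_SigmaFinite.f_integral.
Qed.

End density.

Context {d' : measure_display} {U : measurableType d'}.

(** The image measure is described by its expectations, the only form in which
    it enters below. *)
Lemma weighted_law (mu : {sigma_finite_measure set T -> \bar R})
    (f : T -> \bar R) (phi : T -> U) :
  measurable_fun setT f -> (forall x, 0 <= f x) -> \int[mu]_x f x < +oo ->
  measurable_fun setT phi ->
  exists nu : {finite_measure set U -> \bar R},
    forall F : U -> \bar R, measurable_fun setT F -> (forall u, 0 <= F u) ->
      \int[nu]_u F u = \int[mu]_x (F (phi x) * f x).
Proof.
move=> mf f0 foo mphi; have [m mE] := finite_density_measure mf f0 foo.
pose phiM : {mfun T >-> U} := HB.pack phi (isMeasurableFun.Build _ _ _ _ _ mphi).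
have fin : fin_num_fun (pushforward m phiM).
  by move=> A mA; apply: fin_num_measure; exact: measurable_preimage.
pose nu : {finite_measure set U -> \bar R} :=
  HB.pack (pushforward m phiM) (Measure_isFinite.Build _ _ _ _ fin).
exists (nu mphi mphi mphi mphi) => F mF F0.
have mFphi : measurable_fun setT (F \o phi) by exact: measurableT_comp.
rewrite -(mE (F \o phi))//= ge0_integral_pushforward//.
Qed.

End Weighted.

Lemma integral_indicM {d} {T : measurableType d} {R : realType}
    (mu : {measure set T -> \bar R}) (A : set T) (f : T -> \bar R) :
  (\int[mu]_x ((\1_A x)%:E * f x) = \int[mu]_(x in A) f x)%E.
Proof.
by rewrite [RHS]integral_mkcond epatch_indic; apply: eq_integral => x _; rewrite muleC.
Qed.

Section Weighted_ext.
Local Open Scope ereal_scope.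
Context {d1 d2 : measure_display} {T1 : measurableType d1}
  {T2 : measurableType d2} {R : realType}.
Variables (mu1 : {sigma_finite_measure set T1 -> \bar R})
  (mu2 : {sigma_finite_measure set T2 -> \bar R}).
Variables (f1 : T1 -> \bar R) (f2 : T2 -> \bar R).
Hypotheses (mf1 : measurable_fun setT f1) (f10 : forall x, 0 <= f1 x)
  (mf2 : measurable_fun setT f2) (f20 : forall x, 0 <= f2 x)
  (f1oo : \int[mu1]_x f1 x < +oo).

(** Both sides integrate [F] against finite measures on [U], which the
    hypothesis identifies. *)
Lemma weighted_law_ext {d} {U : measurableType d} (phi1 : T1 -> U) (phi2 : T2 -> U) :
  measurable_fun setT phi1 -> measurable_fun setT phi2 ->
  (forall B, measurable B ->
    \int[mu1]_(x in phi1 @^-1` B) f1 x = \int[mu2]_(x in phi2 @^-1` B) f2 x) ->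
  forall F : U -> \bar R, measurable_fun setT F -> (forall u, 0 <= F u) ->
    \int[mu1]_x (F (phi1 x) * f1 x) = \int[mu2]_x (F (phi2 x) * f2 x).
Proof.
move=> mphi1 mphi2 h12 F mF F0.
have f2oo : \int[mu2]_x f2 x < +oo.
  by have := h12 setT measurableT; rewrite !preimage_setT => <-.
have [nu1 nu1E] := weighted_law mf1 f10 f1oo mphi1.
have [nu2 nu2E] := weighted_law mf2 f20 f2oo mphi2.
rewrite -nu1E// -nu2E//; apply: eq_measure_integral => B mB _.
have iB : measurable_fun setT (fun u : U => (\1_B u)%:E : \bar R).
  exact/measurable_EFinP.
rewrite -(setIT B) -!integral_indic// nu1E//.
rewrite nu2E//.
by rewrite (integral_indicM _ (phi1 @^-1` B)) (integral_indicM _ (phi2 @^-1` B)) h12.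
Qed.

(** Rectangles generate the product sigma-algebra and are stable under
    intersection, so they determine a finite measure. *)
Lemma weighted_law_ext_prod {d d'} {U : measurableType d} {W : measurableType d'}
    (phi1 : T1 -> U * W) (phi2 : T2 -> U * W) :
  measurable_fun setT phi1 -> measurable_fun setT phi2 ->
  (forall A B, measurable A -> measurable B ->
    \int[mu1]_(x in phi1 @^-1` (A `*` B)) f1 x =
    \int[mu2]_(x in phi2 @^-1` (A `*` B)) f2 x) ->
  forall F : U * W -> \bar R, measurable_fun setT F -> (forall u, 0 <= F u) ->
    \int[mu1]_x (F (phi1 x) * f1 x) = \int[mu2]_x (F (phi2 x) * f2 x).
Proof.
move=> mphi1 mphi2 h12 F mF F0.
have f2oo : \int[mu2]_x f2 x < +oo.
  have := h12 setT setT measurableT measurableT.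
  by rewrite setXTT !preimage_setT => <-.
have [nu1 nu1E] := weighted_law mf1 f10 f1oo mphi1.
have [nu2 nu2E] := weighted_law mf2 f20 f2oo mphi2.
rewrite -nu1E// -nu2E//; apply: eq_measure_integral => B mB _.
pose C : set (set (U * W)) :=
  [set A `*` B | A in measurable & B in measurable].
apply: (measure_unique C (fun=> setT)) => //.
- by rewrite measurable_prod_measurableType.
- move=> _ _ [X1 mX1 [X2 mX2 <-]] [Y1 mY1 [Y2 mY2 <-]].
  rewrite -setXI; exists (X1 `&` Y1); first exact: measurableI.
  by exists (X2 `&` Y2) => //; exact: measurableI.
- by move=> _; exists setT => //; exists setT => //; rewrite setXTT.
- by rewrite bigcup_const//; exists 0%N.
- move=> _ [X1 mX1 [X2 mX2 <-]].
  have mX : measurable (X1 `*` X2) by exact: measurableX.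
  have iX : measurable_fun setT (fun u : U * W => (\1_(X1 `*` X2) u)%:E : \bar R).
    exact/measurable_EFinP.
  rewrite -(setIT (X1 `*` X2)) -!integral_indic// nu1E// nu2E//.
  rewrite (integral_indicM _ (phi1 @^-1` (X1 `*` X2))).
  by rewrite (integral_indicM _ (phi2 @^-1` (X1 `*` X2))) h12.
- by move=> _; rewrite ltey_eq fin_num_measure.
Qed.

End Weighted_ext.

(** Stated as an existence so that the type records the finiteness of the
    product. *)
Lemma finite_prod_exists {d1 d2} {T1 : measurableType d1} {T2 : measurableType d2}
    {R : realType} (m1 : {finite_measure set T1 -> \bar R})
    (m2 : {finite_measure set T2 -> \bar R}) :
  exists m : {finite_measure set (T1 * T2)%type -> \bar R},
    forall f : T1 * T2 -> \bar R, measurable_fun setT f -> (forall z, 0 <= f z)%E ->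
      (\int[m]_z f z = \int[m1]_x \int[m2]_y f (x, y) /\
       \int[m]_z f z = \int[m2]_y \int[m1]_x f (x, y))%E.
Proof.
have fin : fin_num_fun (m1 \x m2)%E.
  apply: lty_fin_num_fun; rewrite -setXTT [ltLHS]product_measure1E//.
  by rewrite lte_mul_pinfty// ?fin_num_measure// ltey_eq fin_num_measure.
pose m : {finite_measure set (T1 * T2)%type -> \bar R} :=
  HB.pack (m1 \x m2)%E (Measure_isFinite.Build _ _ _ _ fin).
exists m => f mf f0.
by split; rewrite [LHS]fubini_tonelli1// -fubini_tonelli1// fubini_tonelli2.
Qed.

(** * Conditional expectations *)

Section Conditional_expectation.
Local Open Scope ereal_scope.
Context {d d' : measure_display} {Omega : measurableType d}
  {U : measurableType d'} {R : realType}.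
Variables (P : probability Omega R) (W : Omega -> U).
Hypothesis mW : measurable_fun setT W.

Lemma law_of : exists nu : {finite_measure set U -> \bar R},
  (forall B, measurable B -> nu B = P (W @^-1` B)) /\
  (forall E F, measurable E -> measurable_fun setT F ->
    \int[nu]_(u in E) F u = \int[P]_(w in W @^-1` E) F (W w)).
Proof.
have foo : \int[P]_w (cst 1 w : \bar R) < +oo.
  by rewrite integral_cst// mul1e ltey_eq fin_num_measure.
have c0 (w : Omega) : 0 <= (cst 1 w : \bar R) by [].
have [nu nuE] := weighted_law (@measurable_cst _ _ _ _ setT (1%E : \bar R)) c0 foo mW.
have ge0E E F : measurable E -> measurable_fun setT F -> (forall u, 0 <= F u) ->
    \int[nu]_(u in E) F u = \int[P]_(w in W @^-1` E) F (W w).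
  move=> mE mF F0; rewrite -integral_indicM nuE//.
  - by under eq_integral do rewrite mule1; rewrite (integral_indicM _ (W @^-1` E)).
  - by apply: emeasurable_funM => //; exact/measurable_EFinP.
  - by move=> u; rewrite mule_ge0// lee_fin.
exists nu; split.
  move=> B mB; have mWB := measurable_preimage mW mB.
  have := ge0E B (cst 1) mB (@measurable_cst _ _ _ _ _ _) (fun _ => lee01).
  by rewrite !integral_cst//= !mul1e.
move=> E F mE mF; rewrite integralE [RHS]integralE.
congr (_ - _); rewrite ge0E//.
- by apply: eq_integral => w _; rewrite [RHS](congr1 (@^~ w) (funepos_comp F W)).
- exact: measurable_funepos.
- by apply: eq_integral => w _; rewrite [RHS](congr1 (@^~ w) (funeneg_comp F W)).
- exact: measurable_funeneg.
Qed.

Lemma ae_law (nu : {finite_measure set U -> \bar R}) (p : U -> Prop) :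
  (forall B, measurable B -> nu B = P (W @^-1` B)) ->
  {ae nu, forall u, p u} -> {ae P, forall w, p (W w)}.
Proof.
move=> nuE [N [mN N0 pN]]; exists (W @^-1` N); split.
- exact: measurable_preimage.
- by rewrite -nuE.
- by move=> w /= /pN.
Qed.

(** The image of the weighted measure [X P] under [W] is dominated by that of
    [P]; its Radon-Nikodym derivative is the conditional expectation. *)
Lemma cond_exp_exists (X : Omega -> \bar R) :
  measurable_fun setT X -> (forall w, 0 <= X w) -> \int[P]_w X w < +oo ->
  exists h : U -> \bar R, is_cond_exp P W X h /\ forall u, 0 <= h u.
Proof.
move=> mX X0 Xoo.
have [nu [nuE nuI]] := law_of.
have [nuX nuXE] := weighted_law mX X0 Xoo mW.
have nuXB B : measurable B -> nuX B = \int[P]_(w in W @^-1` B) X w.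
  move=> mB; rewrite measure_integral_indic// nuXE//; last exact: measurable_indicE.
  by rewrite (integral_indicM _ (W @^-1` B)).
have dom : nuX `<< nu.
  apply/null_content_dominatesP => B mB nuB0.
  have mWB := measurable_preimage mW mB.
  have WB0 : P (W @^-1` B) = 0 by rewrite -nuE.
  rewrite nuXB//; apply: null_set_integral => //.
  exact: measurable_funTS.
have [f [f0 _ /measurable_int mf fE]] := radon_nikodym_sigma_finite dom.
exists f; split => //; split => // B mB.
by rewrite -nuI// -fE// nuXB.
Qed.

Lemma cond_exp_unique (X : Omega -> \bar R) (h h' : U -> \bar R) :
  is_cond_exp P W X h -> is_cond_exp P W X h' ->
  \int[P]_w `|h (W w)| < +oo -> {ae P, forall w, h (W w) = h' (W w)}.
Proof.
move=> [mh hE] [mh' h'E] hoo; have [nu [nuE nuI]] := law_of.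
apply: (@ae_law nu (fun u => h u = h' u)) => //.
have : ae_eq nu setT h h'.
  apply: integral_ae_eq => //.
  - apply/integrableP; split => //.
    by rewrite (nuI setT (abse \o h))//; exact: measurableT_comp.
  - by move=> E _ mE; rewrite !nuI// hE// h'E.
by apply: filterS => u; apply.
Qed.

(** Neither version need be integrable, so [cond_exp_unique] does not apply. On
    the set where [h'] is smaller than [h] and at most [n], both have the same
    integral, which is at most [n]; hence they are equal almost everywhere on
    this set, and it is null. *)
Lemma cond_exp_lower (X : Omega -> \bar R) (h h' : U -> \bar R) :
  (forall u, 0 <= h u) -> is_cond_exp P W X h -> is_cond_exp P W X h' ->
  {ae P, forall w, h (W w) <= h' (W w)}.
Proof.
move=> h0 [mh hE] [mh' h'E]; have [nu [nuE nuI]] := law_of.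
apply: (@ae_law nu (fun u => h u <= h' u)) => //.
pose D (n : nat) := [set u | h' u < h u] `&` [set u | h' u <= n%:R%:E].
have mlt : measurable [set u | h' u < h u].
  by rewrite -[X in measurable X]setTI; exact: emeasurable_fun_lt.
have mle n : measurable [set u | h' u <= n%:R%:E].
  by rewrite -[X in measurable X]setTI; exact: emeasurable_fun_le.
have mD n : measurable (D n) by exact: measurableI.
have D0 n : nu (D n) = 0.
  have hh' E : measurable E -> \int[nu]_(u in E) h u = \int[nu]_(u in E) h' u.
    by move=> mE; rewrite !nuI// hE// h'E.
  have hint : nu.-integrable (D n) h.
    apply/integrableP; split; first exact: measurable_funTS.
    under eq_integral do rewrite gee0_abs//.
    rewrite hh'//; apply: (@le_lt_trans _ _ (\int[nu]_(u in D n) n%:R%:E)).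
      rewrite integralE; apply: (@le_trans _ _ (\int[nu]_(u in D n) (h' ^\+) u)).
        by rewrite geeDl// oppe_le0; apply: integral_ge0 => u _; exact: funeneg_ge0.
      apply: ge0_le_integral => //.
      - exact/measurable_funTS/measurable_funepos.
      - by move=> u [_ /= un]; rewrite funeposE ge_max un lee_fin ler0n.
    by rewrite integral_cst// lte_mul_pinfty// ?lee_fin// ltey_eq fin_num_measure.
  have : ae_eq nu (D n) h h'.
    apply: integral_ae_eq => //; first exact: measurable_funTS.
    by move=> E _ mE; exact: hh'.
  move=> [N [mN N0 hN]]; apply: (subset_measure0 _ _ _ N0) => // u Du.
  apply: hN => /= /(_ Du) huh'; case: Du => /=; by rewrite huh' ltxx.
have U0 : nu [set u | h' u < h u] = 0.
  have -> : [set u | h' u < h u] = \bigcup_n D n.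
    apply/seteqP; split => [u /= uh|u [n _ []]//].
    have [h'u|h'u] := leP (h' u) 0; first by exists 0%N.
    have h'fin : h' u \is a fin_num.
      by rewrite ge0_fin_numE ?(ltW h'u)// (lt_le_trans uh)// leey.
    exists (Num.truncn (fine (h' u))).+1 => //; split => //=.
    by rewrite -(fineK h'fin) lee_fin ltW// Num.Theory.truncnS_gt.
  apply/negligibleP; first exact: bigcupT_measurable.
  by apply: negligible_bigcup => n; apply/(negligibleP _ (mD n))/D0.
exists [set u | h' u < h u]; split => // u /= /negP; by rewrite -ltNge.
Qed.

End Conditional_expectation.

(** * Conditioning a binary variable *)

(** The mass that the Bernoulli law with parameter [p] gives to [z]. *)
Definition bernoulli_mass {R : realType} (p : R) (z : bool) : R := if z then p else 1 - p.

Lemma bernoulli_mass_gt0 {R : realType} (p : R) z : 0 < p < 1 -> 0 < bernoulli_mass p z.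
Proof. by move=> /andP[p0 p1]; case: z => //=; rewrite subr_gt0. Qed.

Lemma measurable_bernoulli_mass {d} {U : measurableType d} {R : realType} (pr : U -> R) z :
  measurable_fun setT pr -> measurable_fun setT (fun u => bernoulli_mass (pr u) z).
Proof. by move=> mpr; case: z => //=; exact: measurable_funB. Qed.

Lemma measurable_inv_bernoulli_mass {d} {U : measurableType d} {R : realType} (pr : U -> R) z :
  measurable_fun setT pr -> (forall u, 0 < pr u < 1) ->
  measurable_fun setT (fun u => (bernoulli_mass (pr u) z)^-1%:E).
Proof.
move=> mpr pr01; apply/measurable_EFinP.
rewrite (_ : (fun v => _) = (@powR R)^~ (-1) \o (fun v => bernoulli_mass (pr v) z)).
  exact: (measurableT_comp (measurable_powR _) (measurable_bernoulli_mass z mpr)).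
by apply/funext => v /=; rewrite powR_inv1// ltW// bernoulli_mass_gt0.
Qed.

Section Binary_conditioning.
Local Open Scope ereal_scope.
Context {d d' : measure_display} {Omega : measurableType d}
  {U : measurableType d'} {R : realType}.
Variables (P : probability Omega R) (W : Omega -> U).
Hypothesis mW : measurable_fun setT W.

Lemma integral_indic_fin (A : set Omega) : measurable A ->
  \int[P]_w (\1_A w)%:E < +oo.
Proof. by move=> mA; rewrite -measure_integral_indic// ltey_eq fin_num_measure. Qed.

Lemma cond_probP (A : set Omega) : measurable A ->
  is_cond_exp P W (fun w => (\1_A w)%:E) (cond_prob P W A).
Proof.
move=> mA; rewrite /cond_prob /cond_exp; apply: xgetPex.
have [h [hE _]] := cond_exp_exists mW (measurable_indicE (R := R) mA)
  (fun w => indicE_ge0 A w) (integral_indic_fin mA).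
by exists h.
Qed.

Lemma cond_prob_ae (A : set Omega) (h : U -> \bar R) : measurable A ->
  is_cond_exp P W (fun w => (\1_A w)%:E) h -> (forall u, 0 <= h u) ->
  {ae P, forall w, cond_prob P W A (W w) = h (W w)}.
Proof.
move=> mA hE h0; have := cond_exp_unique mW hE (cond_probP mA).
have -> : \int[P]_w `|h (W w)| < +oo.
  under eq_integral do rewrite gee0_abs//.
  by have := hE.2 setT measurableT; rewrite !preimage_setT => ->; exact: integral_indic_fin.
by move=> /(_ isT); apply: filterS => w ->.
Qed.

(** The weighted measures with weights [h \o W] and [X] have the same image
    under [W]. *)
Lemma cond_exp_pullout (X : Omega -> \bar R) (h k : U -> \bar R) :
  measurable_fun setT X -> (forall w, 0 <= X w) -> \int[P]_w X w < +oo ->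
  is_cond_exp P W X h -> (forall u, 0 <= h u) ->
  measurable_fun setT k -> (forall u, 0 <= k u) ->
  \int[P]_w (k (W w) * h (W w)) = \int[P]_w (k (W w) * X w).
Proof.
move=> mX X0 Xoo [mh hE] h0 mk k0.
apply: (@weighted_law_ext _ _ _ _ _ P P (h \o W)) => //.
- exact: measurableT_comp.
- by move=> x /=.
- by have := hE setT measurableT; rewrite !preimage_setT => ->.
Qed.

(** Under overlap the conditional probability of [Z = true] has a version with
    values in the open unit interval everywhere. *)
Lemma propensity (Z : Omega -> bool) : measurable_fun setT Z -> overlap P Z W ->
  exists pr : U -> R, [/\ measurable_fun setT pr, forall u, (0 < pr u < 1)%R &
    forall z B, measurable B ->
      P (Z @^-1` [set z] `&` W @^-1` B) =
      \int[P]_(w in W @^-1` B) (bernoulli_mass (pr (W w)) z)%:E].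
Proof.
move=> mZ ov; set cp := cond_prob P W (Z @^-1` [set true]) in ov.
have mZz z : measurable (Z @^-1` [set z]) by exact: measurable_preimage.
have [mcp cpE] := cond_probP (mZz true); rewrite -/cp in mcp cpE.
pose ok u := (0 < cp u) && (cp u < 1).
(* The value on the null set where overlap fails is arbitrary in (0, 1). *)
pose pr u := if ok u then fine (cp u) else 2^-1%R.
have mok : measurable_fun setT ok.
  apply: measurable_and.
    by apply: measurable_fun_lte => //.
  by apply: measurable_fun_lte => //.
have mpr : measurable_fun setT pr.
  apply: measurable_fun_ifT => //; exact: measurableT_comp.
have pr01 u : (0 < pr u < 1)%R.
  rewrite /pr; case: ifPn => [/andP[]|_]; last first.
    by rewrite invr_gt0 ltr0n/= invf_lt1 ?ltr0n// ltr1n.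
  by case: (cp u) => // r /=; rewrite !lte_fin => -> ->.
have prE B : measurable B ->
    \int[P]_(w in W @^-1` B) (pr (W w))%:E = P (Z @^-1` [set true] `&` W @^-1` B).
  move=> mB; have mWB := measurable_preimage mW mB.
  rewrite -integral_indic// -cpE//; apply: ae_eq_integral => //.
  - by apply: measurable_funTS; apply/measurable_EFinP; exact: measurableT_comp.
  - by apply: measurable_funTS; exact: measurableT_comp.
  - move: ov; apply: filterS => w okw _; rewrite /pr.
    have -> : ok (W w) by [].
    rewrite fineK//; move: okw => /andP[c0 c1].
    by rewrite ge0_fin_numE ?(ltW c0)// (lt_trans c1)// ltry.
exists pr; split => // z B mB; have mWB := measurable_preimage mW mB.
case: z; first by rewrite /= prE.
rewrite /= (_ : Z @^-1` [set false] = ~` (Z @^-1` [set true])); last first.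
  by apply/seteqP; split => w /=; case: (Z w).
rewrite setIC -setDE measureD//; last by rewrite ltey_eq fin_num_measure.
rewrite [X in _ - X](_ : _ = \int[P]_(w in W @^-1` B) (pr (W w))%:E); last first.
  by rewrite prE// setIC.
under [RHS]eq_integral do rewrite EFinB.
rewrite integralB_EFin//; last 2 first.
- exact: finite_measure_integrable_cst.
- apply: (@le_integrable _ _ _ P _ _ _ (cst 1)) => //.
  + by apply: measurable_funTS; apply/measurable_EFinP; exact: measurableT_comp.
  + move=> w _ /=; have /andP[p0 p1] := pr01 (W w).
    by rewrite lee_fin normr1 gtr0_norm// ltW.
  + exact: finite_measure_integrable_cst.
by rewrite integral_cst// mul1e.
Qed.

Context {d1 : measure_display} {S : measurableType d1}.
Variables (Z : Omega -> bool) (X : Omega -> S) (pr : U -> R).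
Hypotheses (mZ : measurable_fun setT Z) (mX : measurable_fun setT X)
  (mpr : measurable_fun setT pr) (pr01 : forall u, (0 < pr u < 1)%R)
  (prE : forall z B, measurable B ->
      P (Z @^-1` [set z] `&` W @^-1` B) =
      \int[P]_(w in W @^-1` B) (bernoulli_mass (pr (W w)) z)%:E).

Let mZz z : measurable (Z @^-1` [set z]).
Proof. exact: measurable_preimage. Qed.

Let mbern z : measurable_fun setT (fun u => (bernoulli_mass (pr u) z)%:E).
Proof. by apply/measurable_EFinP; exact: measurable_bernoulli_mass. Qed.

Let bern_pr_ge0 z u : 0 <= (bernoulli_mass (pr u) z)%:E.
Proof. by rewrite lee_fin ltW// bernoulli_mass_gt0. Qed.

Let bern_version z : is_cond_exp P W (fun w => (\1_(Z @^-1` [set z]) w)%:E)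
  (fun u => (bernoulli_mass (pr u) z)%:E).
Proof.
split=> // B mB; have mWB := measurable_preimage mW mB.
by rewrite integral_indic// -prE.
Qed.

Lemma propensity_overlap : overlap P Z W.
Proof.
have := cond_prob_ae (mZz true) (bern_version true) (bern_pr_ge0 true).
by apply: filterS => w ->; rewrite !lte_fin; exact: pr01.
Qed.

Lemma propensity_integral z (k : U -> \bar R) :
  measurable_fun setT k -> (forall u, 0 <= k u) ->
  \int[P]_w (k (W w) * (\1_(Z @^-1` [set z]) w)%:E) =
  \int[P]_w (k (W w) * (bernoulli_mass (pr (W w)) z)%:E).
Proof.
move=> mk k0; apply/esym.
apply: (cond_exp_pullout (X := fun w => (\1_(Z @^-1` [set z]) w)%:E)
  (h := fun u => (bernoulli_mass (pr u) z)%:E)) => //.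
- exact: measurable_indicE.
- exact: integral_indic_fin.
Qed.

(** Under overlap both values of [Z] are possible almost everywhere, so a
    property of [(Z, W)] holds for each of them. *)
Lemma propensity_ae (B : set (bool * U)) : measurable B ->
  {ae P, forall w, B (Z w, W w)} -> forall z, {ae P, forall w, B (z, W w)}.
Proof.
move=> mB [N [mN N0 BN]] z.
have mBz : measurable (~` [set u | B (z, u)]).
  by apply: measurableC; exact: (measurable_preimage (pair1_measurable z)).
have ZB0 : P (Z @^-1` [set z] `&` W @^-1` (~` [set u | B (z, u)])) = 0.
  apply: (subset_measure0 _ _ _ N0) => //.
    by apply: measurableI => //; exact: measurable_preimage.
  by move=> w [/= Zz nB]; apply: BN => /=; rewrite Zz.
have mWB := measurable_preimage mW mBz.
move: ZB0; rewrite prE// -integral_indicM => I0.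
have mI : measurable_fun setT (fun w =>
    (\1_(W @^-1` (~` [set u | B (z, u)])) w)%:E * (bernoulli_mass (pr (W w)) z)%:E).
  apply: emeasurable_funM; first exact: measurable_indicE.
  exact: (measurableT_comp (mbern z)).
have : \int[P]_w `|(\1_(W @^-1` (~` [set u | B (z, u)])) w)%:E
    * (bernoulli_mass (pr (W w)) z)%:E| = 0.
  by rewrite -[RHS]I0; apply: eq_integral => w _; rewrite gee0_abs// mule_ge0.
move=> /(ae_eq_integral_abs _ measurableT mI).
apply: filterS => w /(_ I) /= BW0; apply: contrapT => nB.
move: BW0; rewrite indicE mem_set// mul1e => /eqP.
by rewrite eqe gt_eqF// bernoulli_mass_gt0.
Qed.

Let indic_pullout (k : U -> \bar R) (e : U -> \bar R) (B : set S) (D : set U) :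
  measurable B -> measurable D ->
  measurable_fun setT k -> (forall u, 0 <= k u) ->
  is_cond_exp P W (fun w => (\1_(X @^-1` B) w)%:E) e -> (forall u, 0 <= e u) ->
  \int[P]_(w in W @^-1` D) (k (W w) * e (W w)) =
  \int[P]_(w in X @^-1` B `&` W @^-1` D) k (W w).
Proof.
move=> mB mD mk k0 eE e0; have mXB := measurable_preimage mX mB.
rewrite -[LHS]integral_indicM -[RHS]integral_indicM.
transitivity (\int[P]_w (((\1_D (W w))%:E * k (W w)) * e (W w))).
  by apply: eq_integral => w _; rewrite muleA.
rewrite (cond_exp_pullout (k := fun u => (\1_D u)%:E * k u)
  (X := fun w => (\1_(X @^-1` B) w)%:E))//; last 4 first.
- exact: measurable_indicE.
- exact: integral_indic_fin.
- by apply: emeasurable_funM => //; exact: measurable_indicE.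
- by move=> u; rewrite mule_ge0.
by apply: eq_integral => w _; rewrite indicI/= EFinM muleC muleA.
Qed.

(** Conditional independence means that [Z] may be redrawn from its conditional
    law given [W] without changing the joint law with [X] and [W]. *)
Lemma cond_indep_resample : cond_indep P W Z X ->
  forall z (F : S * U -> \bar R), measurable_fun setT F -> (forall x, 0 <= F x) ->
  \int[P]_w (F (X w, W w) * (\1_(Z @^-1` [set z]) w)%:E) =
  \int[P]_w (F (X w, W w) * (bernoulli_mass (pr (W w)) z)%:E).
Proof.
move=> ci z F mF F0.
have mXW : measurable_fun setT (fun w => (X w, W w)) by exact: measurable_fun_pair.
apply: (@weighted_law_ext_prod _ _ _ _ _ P P
  (fun w => (\1_(Z @^-1` [set z]) w)%:E) (fun w => (bernoulli_mass (pr (W w)) z)%:E)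
  _ _ _ _ _ _ _ _ _ (fun w => (X w, W w)) (fun w => (X w, W w))) => //.
- exact: measurable_indicE.
- exact: (measurableT_comp (mbern z)).
- exact: integral_indic_fin.
move=> B D mB mD; rewrite (_ : _ @^-1` _ = X @^-1` B `&` W @^-1` D)//.
have mXB := measurable_preimage mX mB; have mWD := measurable_preimage mW mD.
have mZX := measurableI _ _ (mZz z) mXB.
have mI := measurableI _ _ mXB mWD.
have [e [eE e0]] := cond_exp_exists mW (measurable_indicE (R := R) mXB)
  (fun w => indicE_ge0 _ w) (integral_indic_fin mXB).
rewrite -(indic_pullout mB mD (mbern z) (bern_pr_ge0 z) eE e0).
rewrite integral_indic// setIA -integral_indic// -(cond_probP mZX).2//.
apply: ae_eq_integral => //.
- apply: measurable_funTS; apply: measurableT_comp => //.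
  by have [] := cond_probP mZX.
- apply: measurable_funTS; apply: emeasurable_funM.
    exact: (measurableT_comp (mbern z)).
  by apply: measurableT_comp => //; have [] := eE.
have ez := cond_prob_ae (mZz z) (bern_version z) (bern_pr_ge0 z).
have eX := cond_prob_ae mXB eE e0.
have := ci [set z] B I mB.
by move: ez eX; apply: filterS3 => w /= -> -> ->.
Qed.

(** It suffices to redraw single values of [Z], because a set of truth values
    is a disjoint union of singletons. *)
Lemma resample_cond_indep :
  (forall z B D, measurable B -> measurable D ->
    P (Z @^-1` [set z] `&` (X @^-1` B `&` W @^-1` D)) =
    \int[P]_(w in X @^-1` B `&` W @^-1` D) (bernoulli_mass (pr (W w)) z)%:E) ->
  cond_indep P W Z X.
Proof.
move=> resample A B mA mB.
pose hA u : \bar R := (\1_A true)%:E * (bernoulli_mass (pr u) true)%:E +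
  (\1_A false)%:E * (bernoulli_mass (pr u) false)%:E.
have mhA : measurable_fun setT hA.
  by apply: emeasurable_funD; apply: emeasurable_funM.
have hA0 u : 0 <= hA u by rewrite adde_ge0// mule_ge0.
have mZA : measurable (Z @^-1` A) by exact: measurable_preimage.
have hAE B' D : measurable B' -> measurable D ->
    P (Z @^-1` A `&` (X @^-1` B' `&` W @^-1` D)) =
    \int[P]_(w in X @^-1` B' `&` W @^-1` D) hA (W w).
  move=> mB' mD.
  have mI : measurable (X @^-1` B' `&` W @^-1` D).
    by apply: measurableI; exact: measurable_preimage.
  have iz z : measurable_fun (X @^-1` B' `&` W @^-1` D)
      (fun w => (\1_(Z @^-1` [set z]) w)%:E : \bar R).
    by apply: measurable_funTS; exact: measurable_indicE.
  have bz z : measurable_fun (X @^-1` B' `&` W @^-1` D)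
      (fun w => (bernoulli_mass (pr (W w)) z)%:E : \bar R).
    by apply: measurable_funTS; exact: (measurableT_comp (mbern z)).
  rewrite -integral_indic//.
  transitivity (\int[P]_(w in X @^-1` B' `&` W @^-1` D)
     ((\1_A true)%:E * (\1_(Z @^-1` [set true]) w)%:E +
      (\1_A false)%:E * (\1_(Z @^-1` [set false]) w)%:E)).
    apply: eq_integral => w _; rewrite !indicE -!EFinM -EFinD; congr EFin.
    have inZ C : (w \in Z @^-1` C) = (Z w \in C) by apply/idP/idP; rewrite !inE.
    by rewrite !inZ !classical_sets.in_set1; case: (Z w); rewrite !(mulr1, mulr0, addr0, add0r).
  rewrite /hA !ge0_integralD//; [|by move=> w _; rewrite mule_ge0|
    exact: emeasurable_funM|by move=> w _; rewrite mule_ge0|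
    exact: emeasurable_funM|exact: emeasurable_funM|exact: emeasurable_funM].
  by rewrite !ge0_integralZl_EFin// -!resample// !integral_indic.
have mXB := measurable_preimage mX mB.
have [e [eE e0]] := cond_exp_exists mW (measurable_indicE (R := R) mXB)
  (fun w => indicE_ge0 _ w) (integral_indic_fin mXB).
have hAver : is_cond_exp P W (fun w => (\1_(Z @^-1` A) w)%:E) hA.
  split=> // D mD; have mWD := measurable_preimage mW mD.
  have := hAE setT D measurableT mD; rewrite preimage_setT !setTI => <-.
  by rewrite integral_indic.
have jver : is_cond_exp P W (fun w => (\1_(Z @^-1` A `&` X @^-1` B) w)%:E)
    (fun u => hA u * e u).
  split; first by apply: emeasurable_funM => //; have [] := eE.
  move=> D mD; have mWD := measurable_preimage mW mD.
  rewrite (indic_pullout mB mD mhA hA0 eE e0) -hAE// setIA integral_indic//.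
  exact: measurableI.
have aeA := cond_prob_ae mZA hAver hA0.
have aeX := cond_prob_ae mXB eE e0.
have he0 u : 0 <= hA u * e u by rewrite mule_ge0.
have aeJ := cond_prob_ae (measurableI _ _ mZA mXB) jver he0.
by move: aeA aeX aeJ; apply: filterS3 => w -> -> ->.
Qed.

End Binary_conditioning.

(** * Conditional densities *)

Section Conditional_density.
Local Open Scope ereal_scope.
Context {d d' dS : measure_display} {Omega : measurableType d}
  {U : measurableType d'} {S : measurableType dS} {R : realType}.
Variables (P : probability Omega R) (W : Omega -> U) (X : Omega -> S)
  (mu : {finite_measure set S -> \bar R}).
Hypotheses (mW : measurable_fun setT W) (mX : measurable_fun setT X).

Let mXW : measurable_fun setT (fun w => (X w, W w)).
Proof. exact: measurable_fun_pair. Qed.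

(** Fubini in the form in which conditional densities are defined. *)
Let rect_fubini (nu : {finite_measure set U -> \bar R})
    (munu : {finite_measure set (S * U)%type -> \bar R}) (f : S * U -> \bar R) A B :
  (forall E F, measurable E -> measurable_fun setT F ->
    \int[nu]_(u in E) F u = \int[P]_(w in W @^-1` E) F (W w)) ->
  (forall f, measurable_fun setT f -> (forall z, 0 <= f z) ->
     \int[munu]_z f z = \int[mu]_x \int[nu]_u f (x, u) /\
     \int[munu]_z f z = \int[nu]_u \int[mu]_x f (x, u)) ->
  measurable_fun setT f -> (forall z, 0 <= f z) ->
  measurable A -> measurable B ->
  \int[munu]_(z in A `*` B) f z =
  \int[P]_(w in W @^-1` B) \int[mu]_(x in A) f (x, W w).
Proof.
move=> nuI fub mf f0 mA mB; have mAB : measurable (A `*` B) by exact: measurableX.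
have mfA : measurable_fun setT (fun z => (\1_A z.1)%:E * f z).
  apply: emeasurable_funM => //.
  exact: (measurableT_comp (measurable_indicE mA)).
rewrite -integral_indicM (fub _ _ _).2; last 2 first.
- by apply: emeasurable_funM => //; exact: measurable_indicE.
- by move=> z; rewrite mule_ge0.
have mG := measurable_fun_fubini_tonelli_G (m1 := mu) _ mfA
  (fun z => mule_ge0 (indicE_ge0 A z.1) (f0 z)).
rewrite -(nuI B (fun u => \int[mu]_(x in A) f (x, u)))//; last first.
  by under eq_fun do rewrite -integral_indicM.
rewrite -[RHS]integral_indicM; apply: eq_integral => u _.
rewrite -(integral_indicM _ A) -ge0_integralZl//.
- apply: eq_integral => x _; rewrite muleA; congr (_ * _).
  by rewrite -EFinM !indicE in_setX/=; case: (x \in A); case: (u \in B);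
    rewrite ?(mulr0, mulr1).
- exact: (measurable_fun_pair1 u mfA).
- by move=> x _; rewrite mule_ge0.
Qed.

(** Conditional domination says that the law of [(X, W)] is dominated by the
    product of [mu] and the law of [W]. The Radon-Nikodym derivative is the
    conditional density. *)
Lemma cond_density_exists : cond_dominated P W mu X ->
  exists f, is_cond_density P W mu X f.
Proof.
move=> dom; have [nu [nuE nuI]] := law_of P mW.
have [munu fub] := finite_prod_exists mu nu.
have [nuXW [nuXWE _]] := law_of P mXW.
have nuXW_dom : nuXW `<< munu.
  apply/null_content_dominatesP => N mN N0.
  have PN0 : P [set w | N (X w, W w)] = 0.
    apply: dom => //; apply: (@ae_law _ _ _ _ _ P W mW nu
      (fun u => mu [set x | N (x, u)] = 0)) => //.
    have mG := measurable_fun_fubini_tonelli_G (m1 := mu) _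
      (measurable_indicE (R := R) mN) (fun z => indicE_ge0 N z).
    have : \int[nu]_u `|fubini_G mu (fun z => (\1_N z)%:E) u| = 0.
      under eq_integral do rewrite gee0_abs ?integral_ge0//.
      rewrite -(fub _ _ _).2//; last exact: measurable_indicE.
      by rewrite integral_indic// setIT.
    move=> /(ae_eq_integral_abs _ measurableT mG).
    apply: filterS => u /(_ I) /= <-.
    have mNu : measurable [set x | N (x, u)].
      exact: (measurable_preimage (pair2_measurable u) mN).
    by rewrite measure_integral_indic.
  by rewrite nuXWE.
have [f [f0 ffin fi fE]] := radon_nikodym_sigma_finite nuXW_dom.
have mf := measurable_int _ fi.
exists (fine \o f); split.
- exact: measurableT_comp.
- by move=> z /=; rewrite fine_ge0.
move=> A B mA mB.
rewrite (_ : _ `&` _ = (fun w => (X w, W w)) @^-1` (A `*` B))//.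
rewrite -nuXWE//; last exact: measurableX.
rewrite fE; last exact: measurableX.
rewrite (rect_fubini nuI fub)//; apply: eq_integral => w _.
by apply: eq_integral => x _ /=; rewrite fineK.
Qed.

(** The definition of a conditional density is the case where [F] is the
    indicator of a rectangle. *)
Lemma cond_density_integral (f : S * U -> R) : is_cond_density P W mu X f ->
  forall F : S * U -> \bar R, measurable_fun setT F -> (forall z, 0 <= F z) ->
    \int[P]_w F (X w, W w) =
    \int[P]_w \int[mu]_x (F (x, W w) * (f (x, W w))%:E).
Proof.
move=> [mf f0 fE] F mF F0; have [nu [nuE nuI]] := law_of P mW.
have [munu fub] := finite_prod_exists mu nu.
have mfE : measurable_fun setT (fun z => (f z)%:E) by exact/measurable_EFinP.
have mFf : measurable_fun setT (fun z => F z * (f z)%:E).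
  exact: emeasurable_funM.
have fE0 z : 0 <= (f z)%:E by rewrite lee_fin.
have Ff0 z : 0 <= F z * (f z)%:E by rewrite mule_ge0.
transitivity (\int[munu]_z (F z * (f z)%:E)).
  rewrite -(@weighted_law_ext_prod _ _ _ _ _ P munu (cst 1) (fun z => (f z)%:E)
    _ _ _ _ _ _ _ _ _ (fun w => (X w, W w)) id)//.
  - by under [RHS]eq_integral do rewrite mule1.
  - by rewrite integral_cst// mul1e ltey_eq fin_num_measure.
  move=> A B mA mB; rewrite preimage_id (rect_fubini nuI fub)// -fE//.
  by rewrite integral_cst ?mul1e//; exact: measurable_preimage (measurableX _ _).
rewrite (fub _ _ _).2// nuI//.
exact: (measurable_fun_fubini_tonelli_G (m1 := mu) _ mFf Ff0).
Qed.

End Conditional_density.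

(** * The law of the observed variables *)

Lemma muYT_fin {R : realType} (muY : {finite_measure set R -> \bar R}) :
  fin_num_fun (muYT muY).
Proof.
apply: lty_fin_num_fun; rewrite -setXTT [ltLHS]product_measure1E//.
by rewrite lte_mul_pinfty// ?fin_num_measure// ltey_eq fin_num_measure.
Qed.

Definition finite_muYT {R : realType} (muY : {finite_measure set R -> \bar R}) :
    {finite_measure set (R * bool)%type -> \bar R} :=
  HB.pack (muYT muY) (Measure_isFinite.Build _ _ _ _ (@muYT_fin R muY)).

Section Observed_law.
Local Open Scope ereal_scope.
Context {R : realType} {dV : measure_display} {V : measurableType dV}.
Variables (muY : {finite_measure set R -> \bar R}) (P : probability (obs V R) R).
Local Notation m := (finite_muYT muY).

Lemma measurable_obsV : measurable_fun setT (@obsV dV V R).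
Proof. exact: measurable_snd. Qed.

Lemma measurable_obsZ : measurable_fun setT (@obsZ dV V R).
Proof. exact: (measurableT_comp measurable_snd measurable_fst). Qed.

Lemma measurable_obsYT : measurable_fun setT (@obsYT dV V R).
Proof. exact: (measurableT_comp measurable_fst measurable_fst). Qed.

Lemma measurable_obsY : measurable_fun setT (@obsY dV V R).
Proof. exact: (measurableT_comp measurable_fst measurable_obsYT). Qed.

Lemma measurable_obsZV : measurable_fun setT (@obsZV dV V R).
Proof. exact: measurable_fun_pair measurable_obsZ measurable_obsV. Qed.

(** Adding the binary coordinates [T] and [Z] preserves domination: the
    sections over [T = t] of a null set are null, and by overlap a null event
    given [(Z, V)] is null given [V]. *)
Lemma cond_dominated_obsYT : overlap P obsZ obsV -> cond_dominated P obsV muY obsY ->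
  cond_dominated P obsZV (muYT muY) obsYT.
Proof.
move=> ov dom N mN N0.
have [pr [mpr pr01 prE]] := propensity measurable_obsV measurable_obsZ ov.
have mNzv u : measurable [set x | N (x, u)].
  exact: (measurable_preimage (pair2_measurable u) mN).
have mB : measurable [set u | muYT muY [set x | N (x, u)] = 0].
  have mG := measurable_fun_fubini_tonelli_G (m1 := m) _
    (measurable_indicE (R := R) mN) (fun z => indicE_ge0 N z).
  rewrite (_ : [set u | _] = fubini_G m (fun z => (\1_N z)%:E) @^-1` [set 0]).
    exact: measurable_preimage.
  by apply/seteqP; split => u /=;
    rewrite /fubini_G (measure_integral_indic m (mNzv u)).
have aeB := propensity_ae measurable_obsV measurable_obsZ mpr pr01 prE mB N0.
have Nzt z t : P [set o | N ((obsY o, t), (z, obsV o))] = 0.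
  pose e (x : R * V) : (R * bool) * (bool * V) := ((x.1, t), (z, x.2)).
  have me : measurable_fun setT e.
    by apply: measurable_fun_pair; apply: measurable_fun_pair.
  apply: (dom (e @^-1` N)); first exact: measurable_preimage.
  move: (aeB z); apply: filterS => o /= N0o.
  have mNt : measurable [set x | N ((x, t), (z, obsV o))].
    exact: (measurable_preimage (pair2_measurable t) (mNzv (z, obsV o))).
  have : muYT muY ([set x | N ((x, t), (z, obsV o))] `*` [set t]) = 0.
    apply: (subset_measure0 _ _ _ N0o) => //; first exact: measurableX.
    by move=> [x t'] [/= Nx ->].
  rewrite [LHS]product_measure1E//= /counting_bool /counting asboolT//.
  rewrite fset_set1 finmap.cardfs1 mule1; exact.
pose E z t := [set o : obs V R | N ((obsY o, t), (z, obsV o))].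
have E0 z t : P.-negligible (E z t).
  apply/negligibleP; last exact: Nzt.
  pose e (o : obs V R) : (R * bool) * (bool * V) := ((obsY o, t), (z, obsV o)).
  have me : measurable_fun setT e.
    apply: measurable_fun_pair; apply: measurable_fun_pair => //.
      exact: measurable_obsY.
    exact: measurable_obsV.
  exact: (measurable_preimage me mN).
have mE : measurable [set o : obs V R | N (obsYT o, obsZV o)].
  exact: (measurable_preimage (measurable_fun_pair measurable_obsYT measurable_obsZV) mN).
apply/(negligibleP _ mE).
apply: (negligibleS _ (negligibleU (negligibleU (E0 true true) (E0 true false))
  (negligibleU (E0 false true) (E0 false false)))).
by case=> [[[y []] []] v] /= No; [left; left|right; left|left; right|right; right].
Qed.

Hypothesis admP : admissible_law muY P.

Let f : (R * bool) * (bool * V) -> R := cond_density P obsZV (muYT muY) obsYT.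

Let f_density : is_cond_density P obsZV (muYT muY) obsYT f.
Proof.
have [ov dom _] := admP.
apply: xgetPex; apply: (@cond_density_exists _ _ _ _ _ _ _ P obsZV obsYT m).
- exact: measurable_obsZV.
- exact: measurable_obsYT.
- exact: cond_dominated_obsYT.
Qed.

Let mass (u : bool * V) := \int[m]_x (f (x, u))%:E.

Let mmass : measurable_fun setT mass.
Proof.
have [mf f0 _] := f_density.
apply: (measurable_fun_fubini_tonelli_G (m1 := m) (fun x => (f x)%:E)).
  exact/measurable_EFinP.
by move=> x; rewrite lee_fin.
Qed.

Let mass_ge0 u : 0 <= mass u.
Proof. by have [_ f0 _] := f_density; apply: integral_ge0 => x _; rewrite lee_fin. Qed.

(** Both the mass and the constant one are conditional expectations of one. *)
Let mass1 : {ae P, forall o, mass (obsZV o) = 1}.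
Proof.
have [mf f0 fE] := f_density.
apply: (@cond_exp_unique _ _ _ _ _ P obsZV measurable_obsZV (cst 1) mass (cst 1)).
- split => // B mB; have := fE setT B measurableT mB.
  rewrite preimage_setT setTI => <-.
  by rewrite integral_cst ?mul1e//; exact: measurable_preimage measurable_obsZV mB.
- by split.
under eq_integral do rewrite gee0_abs//.
have := fE setT setT measurableT measurableT.
by rewrite !preimage_setT setTI => <-; rewrite ltey_eq fin_num_measure.
Qed.

(** On the null set of those [(z, v)] where the chosen conditional density does
    not have mass one it is replaced by one of the others. *)
Lemma normalized_cond_density : exists q : (R * bool) * (bool * V) -> R,
  [/\ is_cond_density P obsZV m obsYT q,
      forall u, \int[m]_x (q (x, u))%:E = 1 &
      forall z, {ae P, forall o, forall x,
        fYT muY P z (obsV o) x = q (x, (z, obsV o))}].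
Proof.
have [mf f0 fE] := f_density; have [ov dom _] := admP.
have [u0 mass_u0] : exists u, mass u = 1.
  apply: contrapT => no; move: mass1 => [N [mN N0 noN]].
  have : P setT = 0.
    apply: (subset_measure0 _ _ _ N0) => // o _; apply: noN => /= m1.
    by apply: no; exists (obsZV o).
  by rewrite probability_setT => /eqP; rewrite onee_eq0.
pose q (xu : (R * bool) * (bool * V)) :=
  if mass xu.2 == 1 then f xu else f (xu.1, u0).
have meq1 : measurable_fun setT (fun xu : (R * bool) * (bool * V) => mass xu.2 == 1).
  apply: measurable_fun_eqe => //.
  exact: (measurableT_comp mmass measurable_snd).
have mq : measurable_fun setT q.
  apply: measurable_fun_ifT => //.
  exact: (measurableT_comp mf (measurable_fun_pair measurable_fst (measurable_cst _))).
have q0 x : (0 <= q x)%R by rewrite /q; case: ifP.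
have qE u : mass u = 1 -> forall x, q (x, u) = f (x, u).
  by move=> mu1 x; rewrite /q /= mu1 eqxx.
exists q; split.
- split => // A B mA mB; rewrite fE//.
  have mZVB := measurable_preimage measurable_obsZV mB.
  have mG (g : (R * bool) * (bool * V) -> R) :
      measurable_fun setT g -> (forall x, 0 <= g x)%R ->
      measurable_fun (obsZV @^-1` B)
        (fun o : obs V R => \int[m]_(x in A) (g (x, obsZV o))%:E).
    move=> mg g0; apply: measurable_funTS.
    pose h (z : (R * bool) * (bool * V)) := (\1_A z.1)%:E * (g z)%:E.
    have mh : measurable_fun setT h.
      apply: emeasurable_funM; last exact/measurable_EFinP.
      exact: (measurableT_comp (measurable_indicE mA)).
    have h0 z : 0 <= h z by rewrite mule_ge0// lee_fin.
    have := measurableT_comp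
      (measurable_fun_fubini_tonelli_G (m1 := m) _ mh h0) measurable_obsZV.
    by apply: eq_measurable_fun => o _; rewrite -integral_indicM.
  apply: ae_eq_integral => //; [exact: mG|exact: mG|].
  move: mass1; apply: filterS => o mo _; apply: eq_integral => x _.
  by rewrite qE.
- move=> u; rewrite /q /=; case: (eqVneq (mass u) 1) => [//|_].
  exact: mass_u0.
have [pr [mpr pr01 prE]] := propensity measurable_obsV measurable_obsZ ov.
have mB : measurable [set u | mass u = 1].
  by apply: (measurable_preimage mmass (B := [set 1])).
move=> z; have := propensity_ae measurable_obsV measurable_obsZ mpr pr01 prE mB mass1 z.
by apply: filterS => o /= mo x; rewrite qE.
Qed.

End Observed_law.

(** * The two arms of the observed law *)

(** What is used of the observed law: versions of the propensity and of the
    conditional density of [(Y, T)] without exceptional null sets. *)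
Definition propensity_density {R : realType} {dV : measure_display}
    {V : measurableType dV} (muY : {finite_measure set R -> \bar R})
    (P : probability (obs V R) R) (pr : V -> R)
    (q : (R * bool) * (bool * V) -> R) : Prop :=
  [/\ measurable_fun setT pr, forall v, 0 < pr v < 1 &
    forall z B, measurable B ->
      (P (obsZ @^-1` [set z] `&` obsV @^-1` B) =
       \int[P]_(o in obsV @^-1` B) (bernoulli_mass (pr (obsV o)) z)%:E)%E] /\
  (is_cond_density P obsZV (finite_muYT muY) obsYT q /\
   forall u, (\int[finite_muYT muY]_x (q (x, u))%:E = 1)%E).

(** E[F(S, V)], where S has the density of (Y, T) given Z = z and V. *)
Definition arm_mean {R : realType} {dV : measure_display}
    {V : measurableType dV} (muY : {finite_measure set R -> \bar R})
    (P : probability (obs V R) R) (q : (R * bool) * (bool * V) -> R) (z : bool)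
    (F : (R * bool) * V -> \bar R) : \bar R :=
  (\int[P]_o \int[finite_muYT muY]_s (F (s, obsV o) * (q (s, (z, obsV o)))%:E))%E.

Section Observed_density.
Local Open Scope ereal_scope.
Context {R : realType} {dV : measure_display} {V : measurableType dV}.
Variables (muY : {finite_measure set R -> \bar R}) (P : probability (obs V R) R)
  (pr : V -> R) (q : (R * bool) * (bool * V) -> R).
Hypothesis model : propensity_density muY P pr q.
Local Notation m := (finite_muYT muY).
Local Notation arm_mean := (arm_mean muY P q).

Let mpr : measurable_fun setT pr. Proof. by have [[]] := model. Qed.
Let pr01 v : (0 < pr v < 1)%R. Proof. by have [[]] := model. Qed.
Let prE z B : measurable B -> P (obsZ @^-1` [set z] `&` obsV @^-1` B) =
  \int[P]_(o in obsV @^-1` B) (bernoulli_mass (pr (obsV o)) z)%:E.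
Proof. by have [[_ _ h _]] := model; exact: h. Qed.
Let q_density : is_cond_density P obsZV m obsYT q.
Proof. by have [_ []] := model. Qed.
Let mq : measurable_fun setT q. Proof. by have [] := q_density. Qed.
Let q0 z : (0 <= q z)%R. Proof. by have [] := q_density. Qed.
Let q1 u : \int[m]_x (q (x, u))%:E = 1.
Proof. by have [_ []] := model. Qed.

Lemma measurable_arm z : measurable_fun setT (fun sv : (R * bool) * V =>
  q (sv.1, (z, sv.2))).
Proof.
apply: (measurableT_comp mq); apply: measurable_fun_pair => //.
exact: measurable_fun_pair.
Qed.

Let mFq z (F : (R * bool) * V -> \bar R) : measurable_fun setT F ->
  measurable_fun setT (fun sv => F sv * (q (sv.1, (z, sv.2)))%:E).
Proof.
by move=> mF; apply: emeasurable_funM => //; apply/measurable_EFinP; exact: measurable_arm.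
Qed.

Let Fq0 z (F : (R * bool) * V -> \bar R) : (forall x, 0 <= F x) ->
  forall sv, 0 <= F sv * (q (sv.1, (z, sv.2)))%:E.
Proof. by move=> F0 sv; rewrite mule_ge0// lee_fin. Qed.

Lemma measurable_arm_integral z (F : (R * bool) * V -> \bar R) :
  measurable_fun setT F -> (forall x, 0 <= F x) ->
  measurable_fun setT (fun v => \int[m]_s (F (s, v) * (q (s, (z, v)))%:E)).
Proof.
move=> mF F0.
exact: (measurable_fun_fubini_tonelli_G (m1 := m) _ (mFq z mF) (Fq0 z F0)).
Qed.

(** Conditioning in two steps, on [(Z, V)] and then on [V]. *)
Lemma integral_arm z (F : (R * bool) * V -> \bar R) :
  measurable_fun setT F -> (forall x, 0 <= F x) ->
  \int[P]_o (F (obsYT o, obsV o) * (\1_(obsZ @^-1` [set z]) o)%:E) =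
  \int[P]_o ((bernoulli_mass (pr (obsV o)) z)%:E *
     \int[m]_s (F (s, obsV o) * (q (s, (z, obsV o)))%:E)).
Proof.
move=> mF F0.
pose G (x : (R * bool) * (bool * V)) : \bar R :=
  F (x.1, x.2.2) * (\1_[set z] x.2.1)%:E.
have mG : measurable_fun setT G.
  apply: emeasurable_funM.
    apply: (measurableT_comp mF); apply: measurable_fun_pair => //.
    exact: (measurableT_comp measurable_snd measurable_snd).
  apply: (measurableT_comp (measurable_indicE _)) => //.
  exact: (measurableT_comp measurable_fst measurable_snd).
have G0 x : 0 <= G x by rewrite mule_ge0.
have := cond_density_integral (mu := m) measurable_obsZV measurable_obsYT q_density mG G0.
rewrite (_ : \int[P]_w G (obsYT w, obsZV w) =
  \int[P]_o (F (obsYT o, obsV o) * (\1_(obsZ @^-1` [set z]) o)%:E))//.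
move=> ->.
have mk := measurable_arm_integral z mF F0.
have k0 v : 0 <= \int[m]_s (F (s, v) * (q (s, (z, v)))%:E).
  by apply: integral_ge0 => s _; rewrite mule_ge0// lee_fin.
under [RHS]eq_integral do rewrite muleC.
have <- := propensity_integral measurable_obsV measurable_obsZ mpr pr01 prE z mk k0.
apply: eq_integral => o _; rewrite /G /=.
rewrite (_ : \1_(obsZ @^-1` [set z]) o = \1_[set z] (obsZ o) :> R)//.
have [oz|oz] := eqVneq (obsZ o) z.
  rewrite indicE mem_set//= mule1; apply: eq_integral => s _.
  by rewrite -oz mule1.
rewrite indicE memNset; last by move/eqP; rewrite (negbTE oz).
by rewrite mule0; apply: integral0_eq => s _; rewrite mule0 mul0e.
Qed.

Let mibern z : measurable_fun setT (fun v => ((bernoulli_mass (pr v) z)^-1)%:E).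
Proof. exact: measurable_inv_bernoulli_mass. Qed.

(** Inverse propensity weighting recovers one arm from the observed law. *)
Lemma arm_mean_weighting z (F : (R * bool) * V -> \bar R) :
  measurable_fun setT F -> (forall x, 0 <= F x) ->
  arm_mean z F = \int[P]_o (F (obsYT o, obsV o) *
    ((bernoulli_mass (pr (obsV o)) z)^-1)%:E * (\1_(obsZ @^-1` [set z]) o)%:E).
Proof.
move=> mF F0.
pose G (sv : (R * bool) * V) := F sv * ((bernoulli_mass (pr sv.2) z)^-1)%:E.
have mG : measurable_fun setT G.
  by apply: emeasurable_funM => //; exact: (measurableT_comp (mibern z)).
have G0 sv : 0 <= G sv by rewrite mule_ge0// lee_fin invr_ge0 ltW// bernoulli_mass_gt0.
rewrite (integral_arm z mG G0); apply: eq_integral => o _ /=.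
rewrite -ge0_integralZl//.
- apply: eq_integral => s _; rewrite /G /= -!muleA [RHS]muleCA; congr (_ * _).
  rewrite muleA -EFinM mulfV ?mul1r//.
  by have := bernoulli_mass_gt0 z (pr01 (obsV o)); rewrite lt0r => /andP[].
- exact: (measurable_fun_pair1 (obsV o) (mFq z mG)).
- by move=> s _; exact: (Fq0 z G0 (s, obsV o)).
- by rewrite lee_fin ltW// bernoulli_mass_gt0.
Qed.

Lemma arm_mean_ge0 z F : (forall sv, 0 <= F sv) -> 0 <= arm_mean z F.
Proof.
move=> F0; apply: integral_ge0 => o _; apply: integral_ge0 => s _.
by rewrite mule_ge0// lee_fin.
Qed.

Lemma arm_meanD z1 z2 (F1 F2 : (R * bool) * V -> \bar R) :
  measurable_fun setT F1 -> (forall x, 0 <= F1 x) ->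
  measurable_fun setT F2 -> (forall x, 0 <= F2 x) ->
  arm_mean z1 F1 + arm_mean z2 F2 =
  \int[P]_o \int[m]_s (F1 (s, obsV o) * (q (s, (z1, obsV o)))%:E +
                       F2 (s, obsV o) * (q (s, (z2, obsV o)))%:E).
Proof.
move=> mF1 F10 mF2 F20.
have mo z F (mF : measurable_fun setT F) (F0 : forall x, 0 <= F x) :=
  measurableT_comp (measurable_arm_integral z mF F0) (@measurable_obsV R _ V).
have i0 z (F : (R * bool) * V -> \bar R) (F0 : forall x, 0 <= F x) v :
    0 <= \int[m]_s (F (s, v) * (q (s, (z, v)))%:E).
  by apply: integral_ge0 => s _; rewrite mule_ge0// lee_fin.
rewrite -ge0_integralD//; last 4 first.
- by move=> o _; exact: i0.
- exact: mo.
- by move=> o _; exact: i0.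
- exact: mo.
apply: eq_integral => o _; rewrite ge0_integralD//.
- by move=> s _; exact: (Fq0 z1 F10 (s, obsV o)).
- exact: (measurable_fun_pair1 (obsV o) (mFq z1 mF1)).
- by move=> s _; exact: (Fq0 z2 F20 (s, obsV o)).
- exact: (measurable_fun_pair1 (obsV o) (mFq z2 mF2)).
Qed.

Let common (sv : (R * bool) * V) : R :=
  Num.min (q (sv.1, (false, sv.2))) (q (sv.1, (true, sv.2))).

Let mcommon : measurable_fun setT common.
Proof. by apply: measurable_minr; exact: measurable_arm. Qed.

Let common_ge0 sv : (0 <= common sv)%R.
Proof. by rewrite /common le_min !q0. Qed.

(** One minus the total variation between the two arms given [V = v]. *)
Definition overlap_mass (v : V) : \bar R :=
  \int[m]_s (Num.min (q (s, (false, v))) (q (s, (true, v))))%:E.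

Lemma measurable_overlap_mass : measurable_fun setT overlap_mass.
Proof.
apply: (measurable_fun_fubini_tonelli_G (m1 := m) (fun x => (common x)%:E)).
  exact/measurable_EFinP.
by move=> x; rewrite lee_fin common_ge0.
Qed.

Lemma overlap_mass_ge0 v : 0 <= overlap_mass v.
Proof. by apply: integral_ge0 => s _; rewrite lee_fin (common_ge0 (s, v)). Qed.

Let mqv z v : measurable_fun setT (fun s => (q (s, (z, v)))%:E).
Proof. by apply/measurable_EFinP; exact: (measurable_fun_pair1 (z, v) mq). Qed.

Let mcv v : measurable_fun setT (fun s => (common (s, v))%:E).
Proof. by apply/measurable_EFinP; exact: (measurable_fun_pair1 v mcommon). Qed.

Lemma overlap_mass_le1 v : overlap_mass v <= 1.
Proof.
rewrite -(q1 (false, v)); apply: ge0_le_integral => //.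
- by move=> s _; rewrite lee_fin (common_ge0 (s, v)).
- exact: mcv.
- by move=> s _; rewrite lee_fin ge_min lexx.
Qed.

Lemma overlap_mass_fin v : overlap_mass v \is a fin_num.
Proof.
rewrite ge0_fin_numE ?overlap_mass_ge0//.
by apply: le_lt_trans (overlap_mass_le1 v) _; rewrite ltry.
Qed.

Definition mean_overlap : \bar R := \int[P]_o overlap_mass (obsV o).

Lemma mean_overlap_ge0 : 0 <= mean_overlap.
Proof. by apply: integral_ge0 => o _; exact: overlap_mass_ge0. Qed.

Let mov : measurable_fun setT (fun o : obs V R => overlap_mass (obsV o)).
Proof. exact: (measurableT_comp measurable_overlap_mass measurable_obsV). Qed.

Lemma mean_overlap_le1 : mean_overlap <= 1.
Proof.
have -> : (1 = \int[P]_o cst 1 o :> \bar R).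
  by rewrite integral_cst// mul1e; exact/esym/probability_setT.
apply: ge0_le_integral => //.
- by move=> o _; exact: overlap_mass_ge0.
- by move=> o _; exact: overlap_mass_le1.
Qed.

Lemma mean_overlap_fin : mean_overlap \is a fin_num.
Proof.
rewrite ge0_fin_numE ?mean_overlap_ge0//.
by apply: le_lt_trans mean_overlap_le1 _; rewrite ltry.
Qed.

(** By the identity |a - b| = a + b - 2 min(a, b). *)
Let absdiff_mass v :
  \int[m]_s `|q (s, (true, v)) - q (s, (false, v))|%:E =
  (2 - 2 * fine (overlap_mass v))%:E.
Proof.
have fin := overlap_mass_fin v.
have mabs : measurable_fun setT
    (fun s => `|q (s, (true, v)) - q (s, (false, v))|%:E).
  apply/measurable_EFinP; apply: measurableT_comp => //.
  by apply: measurable_funB; apply/measurable_EFinP; exact: mqv.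
have : \int[m]_s `|q (s, (true, v)) - q (s, (false, v))|%:E +
    (overlap_mass v + overlap_mass v) = 2%:E.
  have c0 s : 0 <= (common (s, v))%:E by rewrite lee_fin common_ge0.
  have -> : overlap_mass v + overlap_mass v =
      \int[m]_s ((common (s, v))%:E + (common (s, v))%:E).
    by rewrite ge0_integralD// => [s _|s _]; exact: c0.
  rewrite -ge0_integralD//; last 2 first.
  - by move=> s _; rewrite adde_ge0// c0.
  - by apply: emeasurable_funD; exact: mcv.
  transitivity (\int[m]_s ((q (s, (true, v)))%:E + (q (s, (false, v)))%:E)).
    apply: eq_integral => s _; rewrite -!EFinD; congr EFin; rewrite /common /=.
    have [qle|/ltW qle] := leP (q (s, (false, v))) (q (s, (true, v))).
      by rewrite ger0_norm ?subr_ge0//; lra.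
    by rewrite ler0_norm ?subr_le0//; lra.
  rewrite ge0_integralD//; [|by move=> s _; rewrite lee_fin|
    by move=> s _; rewrite lee_fin].
  by rewrite !q1.
set I := (X in X + _ = _ -> X = _).
rewrite -(fineK fin); case: I => [r| |] //.
by rewrite -!EFinD => -[E]; congr EFin; rewrite /=; lra.
Qed.

Hypothesis qE : forall z, {ae P, forall o, forall x,
  fYT muY P z (obsV o) x = q (x, (z, obsV o))}.

Lemma mean_TV_overlap : mean_TV_YT muY P = (1 - fine mean_overlap)%R.
Proof.
have [mf f0 _] : is_cond_density P obsZV (muYT muY) obsYT
    (cond_density P obsZV (muYT muY) obsYT).
  by apply: xgetPex; exists q.
rewrite /mean_TV_YT /Rintegral.
have mTV : measurable_fun setT (fun v => TV_YT muY P v).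
  apply: measurable_funM => //; apply: measurableT_comp => //.
  pose h (sv : (R * bool) * V) := `|fYT muY P true sv.2 sv.1
    - fYT muY P false sv.2 sv.1|%:E.
  have mfz z : measurable_fun setT (fun sv : (R * bool) * V =>
      fYT muY P z sv.2 sv.1).
    apply: (measurableT_comp mf); apply: measurable_fun_pair => //.
    exact: measurable_fun_pair.
  apply: (measurable_fun_fubini_tonelli_G (m1 := m) h).
    by apply/measurable_EFinP; apply: measurableT_comp => //; exact: measurable_funB.
  by move=> x; rewrite lee_fin.
rewrite (_ : \int[P]_o (TV_YT muY P (obsV o))%:E =
  \int[P]_o (1 - fine (overlap_mass (obsV o)))%:E).
  under eq_integral do rewrite EFinB fineK ?overlap_mass_fin//.
  rewrite integralB//; last 2 first.
  - exact: finite_measure_integrable_cst.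
  - apply/integrableP; split => //.
    under eq_integral do rewrite gee0_abs ?overlap_mass_ge0//.
    by have := mean_overlap_fin; rewrite ge0_fin_numE ?mean_overlap_ge0.
  rewrite integral_cst// mul1e [X in X - _]probability_setT.
  by rewrite -/mean_overlap -(fineK mean_overlap_fin).
apply: ae_eq_integral => //.
- by apply/measurable_EFinP; exact: (measurableT_comp mTV measurable_obsV).
- apply/measurable_EFinP; apply: measurable_funB => //.
  exact: (measurableT_comp _ mov).
have := qE true; have := qE false; apply: filterS2 => o ef et _.
rewrite /TV_YT /Rintegral; congr EFin.
under eq_integral do rewrite ef et.
rewrite (_ : \int[muYT muY]_x _ = \int[m]_x
  `|q (x, (true, obsV o)) - q (x, (false, obsV o))|%:E)//.
by rewrite absdiff_mass /=; lra.
Qed.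

Lemma cond_exp_density (phi : R * bool -> \bar R) :
  measurable_fun setT phi -> (forall s, 0 <= phi s) ->
  is_cond_exp P obsZV (phi \o obsYT) (fun u => \int[m]_s (phi s * (q (s, u))%:E)).
Proof.
move=> mphi phi0; split.
  apply: (measurable_fun_fubini_tonelli_G (m1 := m)
    (fun x : (R * bool) * (bool * V) => phi x.1 * (q x)%:E)).
    apply: emeasurable_funM; last exact/measurable_EFinP.
    exact: (measurableT_comp mphi measurable_fst).
  by move=> x; rewrite mule_ge0// lee_fin.
move=> B mB.
pose G (x : (R * bool) * (bool * V)) : \bar R := (\1_B x.2)%:E * phi x.1.
have mG : measurable_fun setT G.
  apply: emeasurable_funM.
    exact: (measurableT_comp (measurable_indicE mB) measurable_snd).
  exact: (measurableT_comp mphi measurable_fst).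
have G0 x : 0 <= G x by rewrite mule_ge0.
have GE := cond_density_integral (mu := m) measurable_obsZV measurable_obsYT q_density mG G0.
transitivity (\int[P]_o G (obsYT o, obsZV o)); last exact: integral_indicM.
rewrite GE.
rewrite -[LHS]integral_indicM; apply: eq_integral => o _.
rewrite -ge0_integralZl//.
- by apply: eq_integral => s _; rewrite /G /= muleA.
- apply: emeasurable_funM => //.
  by apply/measurable_EFinP; exact: (measurable_fun_pair1 (obsZV o) mq).
- by move=> s _; rewrite mule_ge0// lee_fin.
Qed.

Hypothesis admP : admissible_law muY P.

(** Admissibility bounds the integral of the chosen version of E[|Y| | Z, V] at
    Z = z against the marginal law of V. By [cond_exp_lower] it dominates the
    version given by the density. *)
Lemma arm_mean_abs_lty z : arm_mean z (fun sv => `|sv.1.1|%:E) < +oo.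
Proof.
have [_ _ /(_ z) Eoo] := admP.
pose phi (s : R * bool) : \bar R := `|s.1|%:E.
have mphi : measurable_fun setT phi.
  by apply/measurable_EFinP; apply: measurableT_comp.
have phi0 s : 0 <= phi s by rewrite lee_fin.
have h0E := cond_exp_density mphi phi0.
set h0 := (fun u => \int[m]_s (phi s * (q (s, u))%:E)) in h0E.
have h0_ge0 u : 0 <= h0 u by apply: integral_ge0 => s _; rewrite mule_ge0// lee_fin.
have HE : is_cond_exp P obsZV (phi \o obsYT)
    (cond_exp P obsZV (fun o => `|(obsY o)%:E|)).
  by apply: (@xgetPex _ _ [set h | is_cond_exp P obsZV (phi \o obsYT) h]); exists h0.
set H := cond_exp _ _ _ in HE.
have mB : measurable [set u | h0 u <= H u].
  rewrite -[X in measurable X]setTI; apply: emeasurable_fun_le => //.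
    by have [] := h0E.
  by have [] := HE.
have leH := propensity_ae measurable_obsV measurable_obsZ mpr pr01 prE mB
  (cond_exp_lower measurable_obsZV h0_ge0 h0E HE) z.
have mHz : measurable_fun setT (fun o : obs V R => H (z, obsV o)).
  apply: (measurableT_comp (HE.1)); apply: measurable_fun_pair => //.
  exact: measurable_obsV.
have mh0z : measurable_fun setT (fun o : obs V R => h0 (z, obsV o)).
  apply: (measurableT_comp (h0E.1)); apply: measurable_fun_pair => //.
  exact: measurable_obsV.
have HposE : \int[P]_o maxe (H (z, obsV o)) 0 = \int[P]_o H (z, obsV o).
  apply: ae_eq_integral => //; first exact: measurable_maxe.
  by move: leH; apply: filterS => o /= le _; rewrite max_l// (le_trans _ le).
apply: le_lt_trans Eoo; rewrite -HposE.
apply: ae_ge0_le_integral => //.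
- by move=> o _; exact: h0_ge0.
- by move=> o _; rewrite le_max lexx orbT.
- exact: measurable_maxe.
- by move: leH; apply: filterS => o /= le _; rewrite le_max le.
Qed.

Definition pos_part (s : R * bool) : \bar R := (Num.max s.1 0)%:E.
Definition neg_part (s : R * bool) : \bar R := (Num.max (- s.1) 0)%:E.

Lemma pos_part_ge0 s : 0 <= pos_part s.
Proof. by rewrite lee_fin le_max lexx orbT. Qed.

Lemma neg_part_ge0 s : 0 <= neg_part s.
Proof. by rewrite lee_fin le_max lexx orbT. Qed.

Lemma measurable_pos_part : measurable_fun setT pos_part.
Proof. by apply/measurable_EFinP; exact: measurable_maxr. Qed.

Lemma measurable_neg_part : measurable_fun setT neg_part.
Proof.
apply/measurable_EFinP; apply: measurable_maxr => //.
exact: measurableT_comp.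
Qed.

Let arm_mean_lty (phi : R * bool -> \bar R) z : measurable_fun setT phi ->
  (forall s, 0 <= phi s) -> (forall s, phi s <= `|s.1|%:E) ->
  arm_mean z (fun sv => phi sv.1) < +oo.
Proof.
move=> mphi phi0 phile; apply: le_lt_trans (arm_mean_abs_lty z).
have mabs : measurable_fun setT (fun sv : (R * bool) * V => `|sv.1.1|%:E).
  apply/measurable_EFinP; apply: measurableT_comp => //.
  exact: (measurableT_comp measurable_fst measurable_fst).
have mphi' : measurable_fun setT (fun sv : (R * bool) * V => phi sv.1).
  exact: (measurableT_comp mphi measurable_fst).
have abs0 (sv : (R * bool) * V) : 0 <= `|sv.1.1|%:E by rewrite lee_fin.
apply: ge0_le_integral => //.
- by move=> o _; apply: integral_ge0 => s _; rewrite mule_ge0// lee_fin.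
- exact: (measurableT_comp (measurable_arm_integral z mphi' (fun sv => phi0 sv.1))
    measurable_obsV).
- exact: (measurableT_comp (measurable_arm_integral z mabs abs0) measurable_obsV).
move=> o _; apply: ge0_le_integral => //.
- by move=> s _; rewrite mule_ge0// lee_fin.
- exact: (measurable_fun_pair1 (obsV o) (mFq z mphi')).
- exact: (measurable_fun_pair1 (obsV o) (mFq z mabs)).
- by move=> s _; rewrite lee_wpmul2r// lee_fin.
Qed.

Lemma arm_mean_pos_lty z : arm_mean z (fun sv => pos_part sv.1) < +oo.
Proof.
apply: arm_mean_lty measurable_pos_part pos_part_ge0 _ => s.
by rewrite lee_fin ge_max ler_norm normr_ge0.
Qed.

Lemma arm_mean_neg_lty z : arm_mean z (fun sv => neg_part sv.1) < +oo.
Proof.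
apply: arm_mean_lty measurable_neg_part neg_part_ge0 _ => s.
by rewrite lee_fin ge_max -normrN ler_norm normr_ge0.
Qed.

(** Splitting the outcome into its positive and negative part leaves only
    integrals of nonnegative functions, all of them finite. *)
Lemma mean_DeltaEYE : (mean_DeltaEY P)%:E =
  (arm_mean true (fun sv => pos_part sv.1) + arm_mean false (fun sv => neg_part sv.1)) -
  (arm_mean true (fun sv => neg_part sv.1) + arm_mean false (fun sv => pos_part sv.1)).
Proof.
pose hp u := \int[m]_s (pos_part s * (q (s, u))%:E).
pose hn u := \int[m]_s (neg_part s * (q (s, u))%:E).
have hpE := cond_exp_density measurable_pos_part pos_part_ge0; rewrite -/hp in hpE.
have hnE := cond_exp_density measurable_neg_part neg_part_ge0; rewrite -/hn in hnE.
have hp0 u : 0 <= hp u.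
  by apply: integral_ge0 => s _; rewrite mule_ge0// ?pos_part_ge0// lee_fin.
have hn0 u : 0 <= hn u.
  by apply: integral_ge0 => s _; rewrite mule_ge0// ?neg_part_ge0// lee_fin.
have mz (h : bool * V -> \bar R) z : measurable_fun setT h ->
    measurable_fun setT (fun o : obs V R => h (z, obsV o)).
  move=> mh; apply: (measurableT_comp mh); apply: measurable_fun_pair => //.
  exact: measurable_obsV.
have mzv (h : bool * V -> \bar R) : measurable_fun setT h ->
    measurable_fun setT (fun o : obs V R => h (obsZV o)).
  by move=> mh; exact: (measurableT_comp mh measurable_obsZV).
have iz (h : bool * V -> \bar R) z : measurable_fun setT h -> (forall u, 0 <= h u) ->
    \int[P]_o h (z, obsV o) < +oo ->
    P.-integrable setT (fun o : obs V R => h (z, obsV o)).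
  move=> mh h0 hoo; apply/integrableP; split; first exact: mz.
  by under eq_integral do rewrite gee0_abs//.
have izv (h : bool * V -> \bar R) : measurable_fun setT h -> (forall u, 0 <= h u) ->
    (forall z, \int[P]_o h (z, obsV o) < +oo) ->
    P.-integrable setT (fun o : obs V R => h (obsZV o)).
  move=> mh h0 hoo; apply/integrableP; split; first exact: mzv.
  under eq_integral do rewrite gee0_abs//.
  apply: (@le_lt_trans _ _
    (\int[P]_o (h (true, obsV o) + h (false, obsV o)))); last first.
    by rewrite ge0_integralD//; [exact: lte_add_pinfty|exact: mz|exact: mz].
  apply: ge0_le_integral => //; first exact: mzv.
    by apply: emeasurable_funD; exact: mz.
  by move=> [[yt []] v] _; rewrite /obsZV/= ?leeDl ?leeDr.
have ipz z := iz hp z hpE.1 hp0 (arm_mean_pos_lty z).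
have inz z := iz hn z hnE.1 hn0 (arm_mean_neg_lty z).
have ip := izv hp hpE.1 hp0 arm_mean_pos_lty.
have in_ := izv hn hnE.1 hn0 arm_mean_neg_lty.
pose Y : obs V R -> \bar R := fun o => (obsY o)%:E.
have hE : is_cond_exp P obsZV Y (fun u => hp u - hn u).
  split; first by apply: emeasurable_funB; [exact: hpE.1|exact: hnE.1].
  move=> B mB.
  have mZVB : measurable ((@obsZV _ V R) @^-1` B).
    exact: measurable_preimage measurable_obsZV mB.
  rewrite integralB//; [|exact: (integrableS measurableT mZVB (@subsetT _ _) ip)|
    exact: (integrableS measurableT mZVB (@subsetT _ _) in_)].
  rewrite hpE.2// hnE.2// [RHS]integralE; congr (_ - _); apply: eq_integral => o _.
    by rewrite funeposE /= /Y /pos_part EFin_max.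
  by rewrite funenegE /= /Y /neg_part EFin_max EFinN.
have EYE : is_cond_exp P obsZV Y (cond_exp P obsZV Y).
  by apply: (@xgetPex _ _ [set h | is_cond_exp P obsZV Y h]); exists (fun u => hp u - hn u).
set H := cond_exp P obsZV Y in EYE.
have hoo : \int[P]_o `|hp (obsZV o) - hn (obsZV o)| < +oo.
  by have /integrableP[] := integrableB measurableT ip in_.
have mB : measurable [set u | hp u - hn u = H u].
  rewrite -[X in measurable X]setTI; apply: emeasurable_fun_eq => //.
    exact: hE.1.
  exact: EYE.1.
have aeH := propensity_ae measurable_obsV measurable_obsZ mpr pr01 prE mB
  (cond_exp_unique measurable_obsZV hE EYE hoo).
have fin_ae (h : bool * V -> \bar R) z : P.-integrable setT (fun o : obs V R => h (z, obsV o)) ->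
    {ae P, forall o, h (z, obsV o) \is a fin_num}.
  by move=> /(integrable_ae measurableT); apply: filterS => o; apply.
rewrite /mean_DeltaEY /Rintegral.
have -> : \int[P]_o (DeltaEY P (obsV o))%:E =
   \int[P]_o ((hp (true, obsV o) + hn (false, obsV o)) -
              (hn (true, obsV o) + hp (false, obsV o))).
  apply: ae_eq_integral => //.
  - apply/measurable_EFinP; apply: measurable_funB;
      apply: (measurableT_comp _ (mz _ _ EYE.1)) => //.
  - by apply: emeasurable_funB; apply: emeasurable_funD; apply: mz;
      by [exact: hpE.1|exact: hnE.1].
  have := ae_and (ae_and (fin_ae hp true (ipz true)) (fin_ae hn true (inz true)))
    (ae_and (fin_ae hp false (ipz false)) (fin_ae hn false (inz false))).
  move=> fin; have := ae_and fin (ae_and (aeH true) (aeH false)).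
  apply: filterS => o [[[pt nt] [pf nf]] [/= Et Ef]] _.
  rewrite /DeltaEY /EY -/Y -/H -Et -Ef.
  rewrite -(fineK pt) -(fineK nt) -(fineK pf) -(fineK nf) /=.
  by rewrite -?EFinD; congr EFin; ring.
have ipn := integrableD measurableT (ipz true) (inz false).
have inp := integrableD measurableT (inz true) (ipz false).
rewrite fineK; last by apply: integrable_fin_num => //; exact: integrableB.
rewrite integralB// (integralD measurableT (ipz true) (inz false)).
by rewrite (integralD measurableT (inz true) (ipz false)).
Qed.

End Observed_density.

(** * The mass of the compliers and their mean effect *)

Section Latent_measurability.
Context {R : realType} {dV : measure_display} {V : measurableType dV}.

Lemma measurable_at {d} {T : measurableType d} {d'} {U : measurableType d'}
    (f : U -> T * T) t : measurable_fun setT f ->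
  measurable_fun setT (fun u => at_ t (f u)).
Proof.
by move=> mf; case: t; [exact: (measurableT_comp measurable_snd mf)|
  exact: (measurableT_comp measurable_fst mf)].
Qed.

Let mf1 : measurable_fun setT (fun w : latent V R => w.1).
Proof. exact: measurable_fst. Qed.
Let mf2 : measurable_fun setT (fun w : latent V R => w.1.1).
Proof. exact: (measurableT_comp measurable_fst mf1). Qed.
Let mf3 : measurable_fun setT (fun w : latent V R => w.1.1.1).
Proof. exact: (measurableT_comp measurable_fst mf2). Qed.

Lemma measurable_latV : measurable_fun setT (@latV dV V R).
Proof. exact: measurable_snd. Qed.

Lemma measurable_latZ : measurable_fun setT (@latZ dV V R).
Proof. exact: (measurableT_comp measurable_snd mf1). Qed.

Lemma measurable_latTstar z : measurable_fun setT (@latTstar dV V R z).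
Proof. exact: measurable_at (measurableT_comp measurable_snd mf2). Qed.

Lemma measurable_latT t : measurable_fun setT (@latT dV V R t).
Proof. exact: measurable_at (measurableT_comp measurable_snd mf3). Qed.

Lemma measurable_latY t : measurable_fun setT (@latY dV V R t).
Proof. exact: measurable_at (measurableT_comp measurable_fst mf3). Qed.

(** The variables of the arm [t] in the order of [obsYT]. *)
Definition latYT (t : bool) (w : latent V R) : R * bool := (latY t w, latT t w).

Lemma measurable_latYT t : measurable_fun setT (latYT t).
Proof. exact: measurable_fun_pair (measurable_latY t) (measurable_latT t). Qed.

Lemma measurable_observe : measurable_fun setT (@observe dV V R).
Proof.
rewrite (_ : @observe dV V R = fun w =>
    ((if if latZ w then latTstar true w else latTstar false w
      then latYT true w else latYT false w), latZ w, latV w)); last first.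
  by apply/funext => w; rewrite /observe /latYT; case: (latZ w); case: (latTstar _ w).
apply: measurable_fun_pair; last exact: measurable_latV.
apply: measurable_fun_pair; last exact: measurable_latZ.
apply: measurable_fun_ifT; [|exact: measurable_latYT|exact: measurable_latYT].
by apply: measurable_fun_ifT; [exact: measurable_latZ|exact: measurable_latTstar|
  exact: measurable_latTstar].
Qed.

Definition takers (z : bool) : set (latent V R) := latTstar z @^-1` [set true].

Lemma measurable_takers z : measurable (takers z).
Proof. exact: measurable_preimage (measurable_latTstar z) _. Qed.

Lemma compliersE : @compliers dV V R = takers true `\` takers false.
Proof.
apply/seteqP; split => w; rewrite /compliers /takers /setD /preimage /mkset;
  move: (latTstar true w) (latTstar false w) => [] [] //=.
- by move=> [_ []].
- by move=> [].
- by move=> [].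
Qed.

Lemma measurable_compliers : measurable (@compliers dV V R).
Proof. by rewrite compliersE; apply: measurableD; exact: measurable_takers. Qed.

End Latent_measurability.

Lemma fin_num_balance {R : realType} (a1 a0 b1 b0 c1 c0 e1 e0 : \bar R) :
  (a1 \is a fin_num -> a0 \is a fin_num -> b1 \is a fin_num -> b0 \is a fin_num ->
   c1 \is a fin_num -> c0 \is a fin_num -> e1 \is a fin_num -> e0 \is a fin_num ->
   a1 + c0 = a0 + c1 -> b1 + e0 = b0 + e1 ->
   (c1 - e1) - (c0 - e0) = (a1 + b0) - (b1 + a0))%E.
Proof.
case: a1 => // a1; case: a0 => // a0; case: b1 => // b1; case: b0 => // b0.
case: c1 => // c1; case: c0 => // c0; case: e1 => // e1; case: e0 => // e0.
by move=> _ _ _ _ _ _ _ _ [ac] [be]; congr (_%:E); lra.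
Qed.

Section Necessity.
Local Open Scope ereal_scope.
Context {R : realType} {dV : measure_display} {V : measurableType dV}.
Variables (muY : {finite_measure set R -> \bar R}) (P : probability (obs V R) R)
  (pr : V -> R) (q : (R * bool) * (bool * V) -> R).
Hypothesis model : propensity_density muY P pr q.
Local Notation m := (finite_muYT muY).
Local Notation arm_mean := (arm_mean muY P q).

Let mpr : measurable_fun setT pr. Proof. by have [[]] := model. Qed.
Let pr01 v : (0 < pr v < 1)%R. Proof. by have [[]] := model. Qed.
Let prE z B : measurable B -> P (obsZ @^-1` [set z] `&` obsV @^-1` B) =
  \int[P]_(o in obsV @^-1` B) (bernoulli_mass (pr (obsV o)) z)%:E.
Proof. by have [[_ _ h _]] := model; exact: h. Qed.

Variable Q : probability (latent V R) R.
Hypotheses (condA : condition_A Q) (indQ : induces Q P).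

Lemma induces_integral (F : obs V R -> \bar R) :
  measurable_fun setT F -> (forall o, 0 <= F o) ->
  \int[Q]_w F (observe w) = \int[P]_o F o.
Proof.
move=> mF F0.
have := @weighted_law_ext _ _ _ _ _ Q P (cst 1) (cst 1) _ _ _ _ _ _ _
  (@observe _ V R) id _ _ _ F mF F0.
rewrite !(eq_integral _ _ (fun x _ => mule1 _)); apply => //.
- by rewrite integral_cst// mul1e ltey_eq fin_num_measure.
- exact: measurable_observe.
- move=> B mB; rewrite preimage_id.
  rewrite !integral_cst//= ?mul1e; first exact: indQ.
  exact: measurable_preimage measurable_observe mB.
Qed.

Let prQ z B : measurable B -> Q (latZ @^-1` [set z] `&` latV @^-1` B) =
  \int[Q]_(w in latV @^-1` B) (bernoulli_mass (pr (latV w)) z)%:E.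
Proof.
move=> mB; rewrite -integral_indicM.
pose F (o : obs V R) : \bar R :=
  (\1_((@obsV _ V R) @^-1` B) o)%:E * (bernoulli_mass (pr (obsV o)) z)%:E.
transitivity (\int[P]_o F o).
  rewrite integral_indicM -prE//.
  rewrite -(indQ (A := obsZ @^-1` [set z] `&` obsV @^-1` B))//.
  apply: measurableI; first exact: measurable_preimage measurable_obsZ _.
  exact: measurable_preimage measurable_obsV mB.
rewrite -induces_integral//.
- apply: emeasurable_funM.
    apply: measurable_indicE; exact: measurable_preimage measurable_obsV mB.
  apply/measurable_EFinP.
  exact: (measurableT_comp (measurable_bernoulli_mass z mpr) measurable_obsV).
- by move=> o; rewrite mule_ge0// lee_fin ltW// bernoulli_mass_gt0.
Qed.

Let mibern z : measurable_fun setT (fun v => ((bernoulli_mass (pr v) z)^-1)%:E).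
Proof. exact: measurable_inv_bernoulli_mass. Qed.

(** Conditionally on [V] the instrument is independent of the latent variables
    of the arm [t], which inverse propensity weighting therefore preserves. *)
Let latent_weighting z t (F : (R * bool) * V -> \bar R) (z' b : bool) :
  measurable_fun setT F -> (forall x, 0 <= F x) ->
  \int[Q]_w (F (latYT t w, latV w) * (\1_(latTstar z' @^-1` [set b]) w)%:E *
     ((bernoulli_mass (pr (latV w)) z)^-1)%:E * (\1_(latZ @^-1` [set z]) w)%:E) =
  \int[Q]_w (F (latYT t w, latV w) * (\1_(latTstar z' @^-1` [set b]) w)%:E).
Proof.
move=> mF F0; have [ci _ _] := condA.
pose X (w : latent V R) := (latT t w, latY t w, latTstar false w, latTstar true w).
have mX : measurable_fun setT X.
  by repeat apply: measurable_fun_pair; [exact: measurable_latT|exact: measurable_latY|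
    exact: measurable_latTstar|exact: measurable_latTstar].
pose G (x : (bool * R * bool * bool) * V) : \bar R :=
  F ((x.1.1.1.2, x.1.1.1.1), x.2) *
  (\1_[set b] (if z' then x.1.2 else x.1.1.2))%:E *
  ((bernoulli_mass (pr x.2) z)^-1)%:E.
have m11 : measurable_fun setT (fun x : (bool * R * bool * bool) * V => x.1.1).
  exact: (measurableT_comp measurable_fst measurable_fst).
have m111 : measurable_fun setT (fun x : (bool * R * bool * bool) * V => x.1.1.1).
  exact: (measurableT_comp measurable_fst m11).
have mG : measurable_fun setT G.
  apply: emeasurable_funM; last exact: (measurableT_comp (mibern z) measurable_snd).
  apply: emeasurable_funM.
    apply: (measurableT_comp mF); apply: measurable_fun_pair => //.
    apply: measurable_fun_pair.
      exact: (measurableT_comp measurable_snd m111).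
    exact: (measurableT_comp measurable_fst m111).
  apply: (measurableT_comp (measurable_indicE _)) => //.
  case: (z'); first exact: (measurableT_comp measurable_snd measurable_fst).
  exact: (measurableT_comp measurable_snd m11).
have G0 x : 0 <= G x.
  by rewrite !mule_ge0// lee_fin invr_ge0 ltW// bernoulli_mass_gt0.
have := cond_indep_resample measurable_latV measurable_latZ mX mpr pr01 prQ (ci t) z mG G0.
have inE w : \1_(latTstar z' @^-1` [set b]) w =
    \1_[set b] (if z' then latTstar true w else latTstar false w) :> R.
  by case: (z').
rewrite (_ : \int[Q]_w (G (X w, latV w) * _) = \int[Q]_w
  (F (latYT t w, latV w) * (\1_(latTstar z' @^-1` [set b]) w)%:E *
     ((bernoulli_mass (pr (latV w)) z)^-1)%:E * (\1_(latZ @^-1` [set z]) w)%:E)); last first.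
  by apply: eq_integral => w _; rewrite inE.
move=> ->; apply: eq_integral => w _; rewrite /G /X /= inE -[RHS]mule1 -muleA.
congr (_ * _); rewrite -EFinM mulVf//.
by have := bernoulli_mass_gt0 z (pr01 (latV w)); rewrite lt0r => /andP[].
Qed.

Let mFt t (F : (R * bool) * V -> \bar R) : measurable_fun setT F ->
  measurable_fun setT (fun w => F (latYT t w, latV w)).
Proof.
move=> mF; apply: (measurableT_comp mF).
exact: measurable_fun_pair (measurable_latYT t) measurable_latV.
Qed.

Let mTb z b : measurable (@latTstar _ V R z @^-1` [set b]).
Proof. exact: measurable_preimage (measurable_latTstar z) _. Qed.

(** The arm [z] of the observed law consists of the takers under [z] with their
    treated outcome and the others with their untreated outcome. *)
Lemma arm_mean_latent z (F : (R * bool) * V -> \bar R) :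
  measurable_fun setT F -> (forall x, 0 <= F x) ->
  arm_mean z F =
  \int[Q]_w (F (latYT true w, latV w) * (\1_(latTstar z @^-1` [set true]) w)%:E) +
  \int[Q]_w (F (latYT false w, latV w) * (\1_(latTstar z @^-1` [set false]) w)%:E).
Proof.
move=> mF F0; rewrite (arm_mean_weighting model z mF F0).
have b0 v : 0 <= ((bernoulli_mass (pr v) z)^-1)%:E by rewrite lee_fin invr_ge0 ltW// bernoulli_mass_gt0.
rewrite -induces_integral; last 2 first.
- apply: emeasurable_funM; last first.
    apply: measurable_indicE; exact: measurable_preimage measurable_obsZ _.
  apply: emeasurable_funM; last exact: (measurableT_comp (mibern z) measurable_obsV).
  apply: (measurableT_comp mF).
  exact: measurable_fun_pair measurable_obsYT measurable_obsV.
- by move=> o; rewrite !mule_ge0.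
rewrite -(latent_weighting z true z true mF F0) -(latent_weighting z false z false mF F0).
have mW t : measurable_fun setT (fun w => F (latYT t w, latV w) *
    (\1_(latTstar z @^-1` [set t]) w)%:E * ((bernoulli_mass (pr (latV w)) z)^-1)%:E *
    (\1_(latZ @^-1` [set z]) w)%:E).
  apply: emeasurable_funM; last first.
    apply: measurable_indicE; exact: measurable_preimage measurable_latZ _.
  apply: emeasurable_funM; last exact: (measurableT_comp (mibern z) measurable_latV).
  by apply: emeasurable_funM; [exact: mFt|exact: measurable_indicE].
rewrite -ge0_integralD//; last 2 first.
- by move=> w _; rewrite !mule_ge0.
- by move=> w _; rewrite !mule_ge0.
apply: eq_integral => w _.
rewrite (_ : \1_(obsZ @^-1` [set z]) (observe w) = \1_(latZ @^-1` [set z]) w :> R)//.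
rewrite [\1_(latZ @^-1` _) w]indicE; have [Zz|] := boolP (w \in _); last first.
  by rewrite !mule0 adde0.
rewrite !mule1.
move: Zz; rewrite inE /preimage /= => Zz.
rewrite -(_ : latZ w = z)//= !indicE.
have inT b : (w \in [set w' | latTstar (latZ w) w' = b]) = (latTstar (latZ w) w == b).
  by apply/idP/eqP; rewrite inE.
rewrite (_ : obsYT (observe w) = latYT (latTstar (latZ w) w) w)// !inT.
by case: (latTstar (latZ w) w); rewrite /= !(mule1, mule0, mul0e, adde0, add0e).
Qed.

(** Without defiers, the untreated under [Z = false] are the untreated under
    [Z = true] and the compliers, and the treated under [Z = true] are the
    treated under [Z = false] and the compliers. The equation is the difference
    of the two arms, with the subtracted terms moved to the other side. *)
Lemma complier_identity (F : (R * bool) * V -> \bar R) :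
  measurable_fun setT F -> (forall x, 0 <= F x) ->
  arm_mean true F + \int[Q]_(w in compliers) F (latYT false w, latV w) =
  arm_mean false F + \int[Q]_(w in compliers) F (latYT true w, latV w).
Proof.
move=> mF F0; have [_ mono _] := condA.
have mC := measurable_compliers (R := R) (V := V).
rewrite -(integral_indicM Q compliers (fun w => F (latYT false w, latV w))).
rewrite -(integral_indicM Q compliers (fun w => F (latYT true w, latV w))).
rewrite !arm_mean_latent//.
pose I z t := \int[Q]_w
  (F (latYT t w, latV w) * (\1_(latTstar z @^-1` [set t]) w)%:E).
pose J t := \int[Q]_w ((\1_compliers w)%:E * F (latYT t w, latV w)).
rewrite -[LHS]/(I true true + I true false + J false).
rewrite -[RHS]/(I false true + I false false + J true).
have mI z t : measurable_fun setT (fun w =>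
    F (latYT t w, latV w) * (\1_(latTstar z @^-1` [set t]) w)%:E).
  by apply: emeasurable_funM; [exact: mFt|exact: measurable_indicE].
have mJ t : measurable_fun setT (fun w =>
    (\1_compliers w)%:E * F (latYT t w, latV w)).
  by apply: emeasurable_funM; [exact: measurable_indicE|exact: mFt].
have EF : I true false + J false = I false false.
  rewrite -ge0_integralD//; [|by move=> w _; rewrite mule_ge0|by move=> w _; rewrite mule_ge0].
  apply: ae_eq_integral => //; first exact: emeasurable_funD.
  move: mono; apply: filterS => w + _; rewrite !indicE.
  have -> : (w \in compliers) = (latTstar false w < latTstar true w)%N.
    by apply/idP/idP; rewrite inE.
  have inT z : (w \in latTstar z @^-1` [set false]) = ~~ latTstar z w.
    by apply/idP/idP; rewrite inE /preimage /mkset; case: (latTstar z w).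
  rewrite !inT; case: (latTstar true w); case: (latTstar false w) => //= _;
    by rewrite !(mule1, mule0, mul1e, mul0e, adde0, add0e).
have ET : I false true + J true = I true true.
  rewrite -ge0_integralD//; [|by move=> w _; rewrite mule_ge0|by move=> w _; rewrite mule_ge0].
  apply: ae_eq_integral => //; first exact: emeasurable_funD.
  move: mono; apply: filterS => w + _; rewrite !indicE.
  have -> : (w \in compliers) = (latTstar false w < latTstar true w)%N.
    by apply/idP/idP; rewrite inE.
  have inT z : (w \in latTstar z @^-1` [set true]) = latTstar z w.
    by apply/idP/idP; rewrite inE /preimage /mkset; case: (latTstar z w).
  rewrite !inT; case: (latTstar true w); case: (latTstar false w) => //= _;
    by rewrite !(mule1, mule0, mul1e, mul0e, adde0, add0e).
by rewrite -addeA EF addeAC ET.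
Qed.

(** On the set [D] where the arm [Z = true] is the denser one, the masses of the
    two arms differ by at most that of the compliers. Off [D] the arm
    [Z = true] is the minimum of the two. *)
Lemma compliers_lower_bound : 1 <= mean_overlap muY P q + Q compliers.
Proof.
pose D := [set sv : (R * bool) * V | (q (sv.1, (false, sv.2)) < q (sv.1, (true, sv.2)))%R].
have mD : measurable D.
  apply: (measurable_preimage (f := fun sv => (q (sv.1, (false, sv.2)) <
    q (sv.1, (true, sv.2)))%R) (B := [set true])) => //.
  by apply: measurable_fun_ltr; exact: (measurable_arm model).
have mCD : measurable (~` D) by exact: measurableC.
pose F sv : \bar R := (\1_D sv)%:E; pose G sv : \bar R := (\1_(~` D) sv)%:E.
have mF : measurable_fun setT F by exact: measurable_indicE.
have mG : measurable_fun setT G by exact: measurable_indicE.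
have F0 sv : 0 <= F sv by exact: indicE_ge0.
have G0 sv : 0 <= G sv by exact: indicE_ge0.
have FG sv : F sv = (sv \in D)%:R%:E /\ G sv = (sv \notin D)%:R%:E.
  by rewrite /F /G !indicE in_setC.
have total : arm_mean true F + arm_mean true G = 1.
  rewrite (arm_meanD model)//.
  rewrite -[RHS](@probability_setT _ _ _ P) -[RHS]mul1e -integral_cst//.
  apply: eq_integral => o _; rewrite -[RHS](model.2.2 (true, obsV o)).
  apply: eq_integral => s _; have [-> ->] := FG (s, obsV o).
  by case: (_ \in _); rewrite /= !(mul1e, mul0e, adde0, add0e).
have shared : arm_mean false F + arm_mean true G = mean_overlap muY P q.
  rewrite (arm_meanD model)//.
  apply: eq_integral => o _; apply: eq_integral => s _.
  have [-> ->] := FG (s, obsV o).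
  case: (boolP (_ \in D)); rewrite ?inE ?notin_setE /D /= => lt.
    by rewrite mul1e mul0e adde0 min_l// ltW.
  by rewrite mul0e mul1e add0e min_r// leNgt; exact/negP.
have mC := measurable_compliers (R := R) (V := V).
have FC : \int[Q]_(w in compliers) F (latYT true w, latV w) <= Q compliers.
  rewrite -[leRHS]mul1e -integral_cst//; apply: ge0_le_integral => //.
  - by apply: measurable_funTS; exact: mFt.
  - by move=> w _; rewrite /F lee_fin indicE; case: (_ \in _).
have FTle : arm_mean true F <= arm_mean false F + Q compliers.
  apply: (@le_trans _ _ (arm_mean true F +
      \int[Q]_(w in compliers) F (latYT false w, latV w))).
    by rewrite leeDl// integral_ge0.
  by rewrite complier_identity// leeD2l.
have := leeD2r (arm_mean true G) FTle.
by rewrite total addeAC shared.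
Qed.

Hypothesis admP : admissible_law muY P.

(** The compliers are treated under [Z = true] and untreated under
    [Z = false], so each of their outcomes is part of an arm. *)
Let complier_part_lty t (phi : R * bool -> \bar R) :
  measurable_fun setT phi -> (forall s, 0 <= phi s) ->
  (forall z, arm_mean z (fun sv => phi sv.1) < +oo) ->
  \int[Q]_(w in compliers) phi (latYT t w) < +oo.
Proof.
move=> mphi phi0 /(_ t); apply: le_lt_trans.
have mF : measurable_fun setT (fun sv : (R * bool) * V => phi sv.1).
  exact: (measurableT_comp mphi measurable_fst).
rewrite (arm_mean_latent t mF)//.
have mC := measurable_compliers (R := R) (V := V).
apply: (@le_trans _ _ (\int[Q]_w (phi (latYT t w) * (\1_(latTstar t @^-1` [set t]) w)%:E))).
  rewrite -integral_indicM; apply: ge0_le_integral => //.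
  - by move=> w _; rewrite mule_ge0.
  - apply: emeasurable_funM; first exact: measurable_indicE.
    exact: (measurableT_comp mphi (measurable_latYT t)).
  - apply: emeasurable_funM; last exact: measurable_indicE.
    exact: (measurableT_comp mphi (measurable_latYT t)).
  move=> w _; rewrite muleC lee_wpmul2l// lee_fin !indicE ler_nat.
  have [|//] := boolP (w \in compliers); rewrite inE => Cw.
  rewrite mem_set//; move: Cw; rewrite /compliers /preimage /mkset.
  by case: t; case: (latTstar true w); case: (latTstar false w).
by case: t => /=; rewrite ?leeDl ?leeDr// integral_ge0// => w _; rewrite mule_ge0.
Qed.

Let pos_lty t := complier_part_lty t (@measurable_pos_part R) (@pos_part_ge0 R)
  (arm_mean_pos_lty model admP).

Let neg_lty t := complier_part_lty t (@measurable_neg_part R) (@neg_part_ge0 R)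
  (arm_mean_neg_lty model admP).

Let pos_funE t : (fun w => (latY t w)%:E)^\+ = (fun w : latent V R => pos_part (latYT t w)).
Proof. by apply/funext => w; rewrite funeposE /pos_part EFin_max. Qed.

Let neg_funE t : (fun w => (latY t w)%:E)^\- = (fun w : latent V R => neg_part (latYT t w)).
Proof. by apply/funext => w; rewrite funenegE /neg_part EFin_max EFinN. Qed.

Lemma complier_outcome_integrable t :
  Q.-integrable compliers (fun w => (latY t w)%:E).
Proof.
have mC := measurable_compliers (R := R) (V := V).
have mYC : measurable_fun compliers (fun w : latent V R => (latY t w)%:E).
  by apply: measurable_funTS; apply/measurable_EFinP; exact: measurable_latY.
apply/integrableP; split => //.
rewrite (eq_integral (fun w => pos_part (latYT t w) + neg_part (latYT t w))).
  rewrite ge0_integralD//; first exact: lte_add_pinfty (pos_lty t) (neg_lty t).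
  - by move=> w _; exact: pos_part_ge0.
  - apply: measurable_funTS.
    exact: (measurableT_comp (@measurable_pos_part R) (measurable_latYT t)).
  - by move=> w _; exact: neg_part_ge0.
  - apply: measurable_funTS.
    exact: (measurableT_comp (@measurable_neg_part R) (measurable_latYT t)).
move=> w _; rewrite /pos_part /neg_part -EFinD /=; congr EFin.
have [y0|/ltW y0] := leP 0%R (latY t w).
  by rewrite ger0_norm//  max_r ?oppr_le0// addr0.
by rewrite ler0_norm//  max_l ?oppr_ge0// add0r.
Qed.

(** The identity [complier_identity] for the positive and the negative part of
    the outcome. *)
Lemma complier_effect :
  \int[Q]_(w in compliers) (latY true w - latY false w)%:E = (mean_DeltaEY P)%:E.
Proof.
have mC := measurable_compliers (R := R) (V := V).
rewrite (eq_integral (fun w => (latY true w)%:E - (latY false w)%:E)); last first.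
  by move=> w _; rewrite EFinB.
rewrite integralB//; [|exact: complier_outcome_integrable|exact: complier_outcome_integrable].
rewrite integralE [X in _ - X]integralE !pos_funE !neg_funE (mean_DeltaEYE model admP).
have mFp : measurable_fun setT (fun sv : (R * bool) * V => pos_part sv.1).
  exact: (measurableT_comp (@measurable_pos_part R) measurable_fst).
have mFn : measurable_fun setT (fun sv : (R * bool) * V => neg_part sv.1).
  exact: (measurableT_comp (@measurable_neg_part R) measurable_fst).
have := complier_identity mFp (fun sv => pos_part_ge0 sv.1).
have := complier_identity mFn (fun sv => neg_part_ge0 sv.1).
have Cp t : \int[Q]_(w in compliers) pos_part (latYT t w) \is a fin_num.
  rewrite ge0_fin_numE ?pos_lty// integral_ge0// => w _; exact: pos_part_ge0.
have Cn t : \int[Q]_(w in compliers) neg_part (latYT t w) \is a fin_num.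
  rewrite ge0_fin_numE ?neg_lty// integral_ge0// => w _; exact: neg_part_ge0.
have Ap z : arm_mean z (fun sv => pos_part sv.1) \is a fin_num.
  rewrite ge0_fin_numE ?(arm_mean_pos_lty model admP)//.
  by apply: (arm_mean_ge0 model) => sv; exact: pos_part_ge0.
have An z : arm_mean z (fun sv => neg_part sv.1) \is a fin_num.
  rewrite ge0_fin_numE ?(arm_mean_neg_lty model admP)//.
  by apply: (arm_mean_ge0 model) => sv; exact: neg_part_ge0.
move=> En Ep; exact: fin_num_balance (Ap _) (Ap _) (An _) (An _) (Cp _) (Cp _) (Cn _)
  (Cn _) Ep En.
Qed.

End Necessity.

(** * Coupling two subdensities *)

Lemma integral_counting_bool {R : realType} (g : bool -> \bar R) :
  (forall b, 0 <= g b)%E ->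
  (\int[@counting_bool R]_b g b = g true + g false)%E.
Proof.
move=> g0.
have mg : measurable_fun setT g by [].
have -> : [set: bool] = [set true] `|` [set false].
  by apply/seteqP; split => -[] //= _; [left|right].
rewrite ge0_integral_setU//; last first.
  by apply/disj_set2P/seteqP; split => // -[] [].
have one b : (\int[@counting_bool R]_(x in [set b]) g x = g b)%E.
  rewrite (eq_integral (cst (g b))); last by move=> x; rewrite inE => ->.
  rewrite integral_cst//= /counting_bool /counting asboolT//.
  by rewrite fset_set1 finmap.cardfs1 mule1.
by rewrite !one.
Qed.

Section Coupling.
Local Open Scope ereal_scope.
Context {R : realType} {dS dU : measure_display} {S : measurableType dS}
  {U : measurableType dU}.
Variables (m : {finite_measure set S -> \bar R})
  (mu : {finite_measure set U -> \bar R}).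
Variables (b : bool -> S * U -> R) (W : U -> R).
Hypotheses (mb : forall t, measurable_fun setT (b t))
  (b0 : forall t x, (0 <= b t x)%R) (mW : measurable_fun setT W)
  (bW : forall t u, \int[m]_s (b t (s, u))%:E = (W u)%:E)
  (Woo : \int[mu]_u (W u)%:E < +oo).

Let W0 u : (0 <= W u)%R.
Proof. by rewrite -lee_fin -(bW true); apply: integral_ge0 => s _; rewrite lee_fin. Qed.

Let miW : measurable_fun setT (fun u => (W u)^-1%R).
Proof.
rewrite (_ : (fun u => _) = (@powR R)^~ (-1)%R \o W).
  exact: (measurableT_comp (measurable_powR _) mW).
by apply/funext => u /=; rewrite powR_inv1.
Qed.

Let mbu t u : measurable_fun setT (fun s => (b t (s, u))%:E).
Proof. by apply/measurable_EFinP; exact: (measurable_fun_pair1 u (mb t)). Qed.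

(** Dividing by the mass and multiplying by it again loses nothing, as the
    density vanishes almost everywhere when its mass is zero. *)
Let normalize_mass t u (g : S -> \bar R) : measurable_fun setT g ->
  (forall s, 0 <= g s) ->
  \int[m]_s (g s * (b t (s, u))%:E * ((W u)^-1)%:E * (W u)%:E) =
  \int[m]_s (g s * (b t (s, u))%:E).
Proof.
move=> mg g0; have [Wu0|Wu0] := eqVneq (W u) 0%R; last first.
  by apply: eq_integral => s _; rewrite -muleA -EFinM mulVf// mule1.
rewrite integral0_eq; last by move=> s _; rewrite Wu0 mule0.
have : \int[m]_s `|(b t (s, u))%:E| = 0.
  by under eq_integral do rewrite gee0_abs ?lee_fin//; rewrite bW Wu0.
move=> /(ae_eq_integral_abs m measurableT (mbu t u)) ae0.
rewrite (ae_eq_integral (cst 0)) ?integral0//; first exact: emeasurable_funM.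
by move: ae0; apply: filterS => s /(_ I) /= -> _; rewrite mule0.
Qed.

(** The two coordinates are drawn independently given [u], with the densities
    [b t] divided by their common mass [W u]. Only expectations of functions of
    one of the coordinates and of [u] are described: they do not depend on the
    way the two are coupled. *)
Lemma coupling : exists Gam : {finite_measure set ((S * S) * U)%type -> \bar R},
  forall t (F : (S * S) * U -> \bar R), measurable_fun setT F -> (forall x, 0 <= F x) ->
    (forall s u, F (s, u) = F ((at_ t s, at_ t s), u)) ->
    \int[Gam]_x F x = \int[mu]_u \int[m]_s (F ((s, s), u) * (b t (s, u))%:E).
Proof.
have [mm fubm] := finite_prod_exists m m.
have [mmu fub] := finite_prod_exists mm mu.
(* Where [W] vanishes the inverse is zero, and so is the density. *)
pose D (x : (S * S) * U) : \bar R :=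
  (b false (x.1.1, x.2))%:E * (b true (x.1.2, x.2))%:E * ((W x.2)^-1)%:E.
have m1 : measurable_fun setT (fun x : (S * S) * U => x.1.1).
  exact: (measurableT_comp measurable_fst measurable_fst).
have m2 : measurable_fun setT (fun x : (S * S) * U => x.1.2).
  exact: (measurableT_comp measurable_snd measurable_fst).
have mD : measurable_fun setT D.
  apply: emeasurable_funM; last first.
    by apply/measurable_EFinP; exact: (measurableT_comp miW measurable_snd).
  by apply: emeasurable_funM; apply/measurable_EFinP;
    apply: (measurableT_comp (mb _)); apply: measurable_fun_pair.
have D0 x : 0 <= D x by rewrite /D -!EFinM lee_fin !mulr_ge0// invr_ge0.
have key t (F : (S * S) * U -> \bar R) : measurable_fun setT F -> (forall x, 0 <= F x) ->
    (forall s u, F (s, u) = F ((at_ t s, at_ t s), u)) ->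
    \int[mmu]_x (F x * D x) = \int[mu]_u \int[m]_s (F ((s, s), u) * (b t (s, u))%:E).
  move=> mF F0 Ft.
  have mFD : measurable_fun setT (fun x => F x * D x) by exact: emeasurable_funM.
  have FD0 x : 0 <= F x * D x by rewrite mule_ge0.
  rewrite (fub _ mFD FD0).2; apply: eq_integral => u _.
  have mFu : measurable_fun setT (fun s => F ((s, s), u)).
    apply: (measurableT_comp mF); apply: measurable_fun_pair => //.
    exact: measurable_fun_pair.
  have mFDu := measurable_fun_pair1 u mFD.
  have FDu0 s : 0 <= F (s, u) * D (s, u) by [].
  rewrite -(normalize_mass t u mFu) //.
  case: t Ft => Ft.
    rewrite (fubm _ mFDu FDu0).2; apply: eq_integral => s _.
    rewrite -[in RHS](bW false u) -ge0_integralZl//; last 2 first.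
    - by move=> s' _; rewrite lee_fin.
    - by rewrite !mule_ge0// lee_fin// invr_ge0.
    apply: eq_integral => s' _; rewrite Ft /D /= -!muleA; congr (_ * _).
    by rewrite -!EFinM; congr EFin; ring.
  rewrite (fubm _ mFDu FDu0).1; apply: eq_integral => s _.
  rewrite -[in RHS](bW true u) -ge0_integralZl//; last 2 first.
  - by move=> s' _; rewrite lee_fin.
  - by rewrite !mule_ge0// lee_fin// invr_ge0.
  apply: eq_integral => s' _; rewrite Ft /D /= -!muleA; congr (_ * _).
  by rewrite -!EFinM; congr EFin; ring.
have Doo : \int[mmu]_x D x < +oo.
  rewrite (eq_integral (fun x => (cst 1 x : \bar R) * D x)); last first.
    by move=> x _; rewrite mul1e.
  rewrite (key true)// (eq_integral (fun u => (W u)%:E))// => u _.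
  by rewrite -(bW true); apply: eq_integral => s _; rewrite mul1e.
have [Gam GamE] := weighted_law mD D0 Doo (@measurable_id _ _ setT).
by exists Gam => t F mF F0 Ft; rewrite GamE// (key t).
Qed.

End Coupling.

(** * Realizing a given mass of compliers *)

Section Sufficiency.
Local Open Scope ereal_scope.
Context {R : realType} {dV : measure_display} {V : measurableType dV}.
Variables (muY : {finite_measure set R -> \bar R}) (P : probability (obs V R) R)
  (pr : V -> R) (q : (R * bool) * (bool * V) -> R).
Hypothesis model : propensity_density muY P pr q.
Local Notation m := (finite_muYT muY).
Local Notation S := (R * bool)%type.
Local Notation U := (bool * (bool * V))%type.

Let mpr : measurable_fun setT pr. Proof. by have [[]] := model. Qed.
Let pr01 v : (0 < pr v < 1)%R. Proof. by have [[]] := model. Qed.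
Let prE z B : measurable B -> P (obsZ @^-1` [set z] `&` obsV @^-1` B) =
  \int[P]_(o in obsV @^-1` B) (bernoulli_mass (pr (obsV o)) z)%:E.
Proof. by have [[_ _ h _]] := model; exact: h. Qed.
Let q_density : is_cond_density P obsZV m obsYT q.
Proof. by have [_ []] := model. Qed.
Let mq : measurable_fun setT q. Proof. by have [] := q_density. Qed.
Let q0 z : (0 <= q z)%R. Proof. by have [] := q_density. Qed.
Let q1 u : \int[m]_x (q (x, u))%:E = 1.
Proof. by have [_ []] := model. Qed.

Variable lam : R.
Hypothesis lam01 : (0 <= lam <= 1)%R.

(** The subdensity of the never-takers: a fraction of what the two arms have
    in common. *)
Let never (s : S) (v : V) : R :=
  (lam * Num.min (q (s, (false, v))) (q (s, (true, v))))%R.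

Let never_ge0 s v : (0 <= never s v)%R.
Proof. by have /andP[l0 _] := lam01; rewrite mulr_ge0// le_min !q0. Qed.

Let never_le t s v : (never s v <= q (s, (t, v)))%R.
Proof.
have /andP[l0 l1] := lam01.
apply: (@le_trans _ _ (Num.min (q (s, (false, v))) (q (s, (true, v))))).
  by rewrite ler_piMl// le_min !q0.
by case: t; rewrite ge_min lexx ?orbT.
Qed.

(** The subdensity of the arm [t] given [V] on the compliers, whose label is
    [true], and on the never-takers. Given [V] it is the same for both values of
    [Z], as condition (A) demands. *)
Let b (t : bool) (x : S * U) : R :=
  if x.2.1 then (q (x.1, (t, x.2.2.2)) - never x.1 x.2.2.2)%R
  else never x.1 x.2.2.2.

Let kap (v : V) : R := fine (overlap_mass muY q v).

(** The mass of the type given [V]. *)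
Let W (u : U) : R := if u.1 then (1 - lam * kap u.2.2)%R else (lam * kap u.2.2)%R.

Let mV : measurable_fun setT (fun x : S * U => x.2.2.2).
Proof.
exact: (measurableT_comp measurable_snd (measurableT_comp measurable_snd measurable_snd)).
Qed.

Let marm t : measurable_fun setT (fun x : S * U => q (x.1, (t, x.2.2.2))).
Proof.
apply: (measurableT_comp mq); apply: measurable_fun_pair => //.
exact: measurable_fun_pair.
Qed.

Let mnever : measurable_fun setT (fun x : S * U => never x.1 x.2.2.2).
Proof.
by apply: measurable_funM => //; apply: measurable_minr; exact: marm.
Qed.

Let mb t : measurable_fun setT (b t).
Proof.
apply: measurable_fun_ifT => //.
  exact: (measurableT_comp measurable_fst measurable_snd).
by apply: measurable_funB => //; exact: marm.
Qed.

Let b0 t x : (0 <= b t x)%R.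
Proof. by rewrite /b; case: ifP => _ //; rewrite subr_ge0. Qed.

Let mkap : measurable_fun setT kap.
Proof. by apply: measurableT_comp => //; exact: (measurable_overlap_mass model). Qed.

Let mW : measurable_fun setT W.
Proof.
have mk : measurable_fun setT (fun u : U => (lam * kap u.2.2)%R).
  have m22 : measurable_fun setT (fun u : U => u.2.2).
    exact: (measurableT_comp measurable_snd measurable_snd).
  by apply: measurable_funM => //; exact: (measurableT_comp mkap m22).
apply: measurable_fun_ifT => //.
exact: measurable_funB.
Qed.

Let kapE v : (kap v)%:E = overlap_mass muY q v.
Proof. by rewrite fineK// (overlap_mass_fin model). Qed.

Let mqu t v : measurable_fun setT (fun s => (q (s, (t, v)))%:E).
Proof. by apply/measurable_EFinP; exact: (measurable_fun_pair1 (t, v) mq). Qed.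

Let mneveru v : measurable_fun setT (fun s => (never s v)%:E).
Proof.
apply/measurable_EFinP; exact: (measurable_fun_pair1 (true, (true, v)) mnever).
Qed.

Let never_mass v : \int[m]_s (never s v)%:E = (lam * kap v)%:E.
Proof.
have /andP[l0 l1] := lam01.
under eq_integral do rewrite EFinM.
rewrite ge0_integralZl//.
- by rewrite EFinM kapE.
- apply/measurable_EFinP; apply: measurable_minr; apply/measurable_EFinP; exact: mqu.
- by move=> s _; rewrite lee_fin le_min !q0.
Qed.

Let bW t u : \int[m]_s (b t (s, u))%:E = (W u)%:E.
Proof.
case: u => -[] [z v]; last exact: never_mass.
rewrite -[LHS]/(\int[m]_s (q (s, (t, v)) - never s v)%:E).
rewrite -[RHS]/((1 - lam * kap v)%:E).
have : \int[m]_s (q (s, (t, v)) - never s v)%:E + \int[m]_s (never s v)%:E = 1.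
  rewrite -ge0_integralD//.
  - by rewrite -[RHS](q1 (t, v)); apply: eq_integral => s _; rewrite -EFinD subrK.
  - by move=> s _; rewrite lee_fin subr_ge0.
  - by under eq_fun do rewrite EFinB; exact: emeasurable_funB.
  - by move=> s _; rewrite lee_fin.
by rewrite never_mass => E; rewrite EFinB -E addeK.
Qed.

Let kap01 v : (0 <= kap v <= 1)%R.
Proof. by rewrite -!lee_fin kapE (overlap_mass_ge0 model)//= (overlap_mass_le1 model). Qed.

(** Nobody is treated under [Z = false]; the label says who is treated under
    [Z = true]. *)
Let latent_of (x : (S * S) * U) : latent V R :=
  (((x.1.1.1, x.1.2.1), (x.1.1.2, x.1.2.2)), (false, x.2.1), x.2.2.1, x.2.2.2).

Let mlatent_of : measurable_fun setT latent_of.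
Proof.
have m1 : measurable_fun setT (fun x : (S * S) * U => x.1) by exact: measurable_fst.
have m2 : measurable_fun setT (fun x : (S * S) * U => x.2) by exact: measurable_snd.
have m11 := measurableT_comp (@measurable_fst _ _ S S) m1.
have m12 := measurableT_comp (@measurable_snd _ _ S S) m1.
have m21 := measurableT_comp (@measurable_fst _ _ bool (bool * V)%type) m2.
have m22 := measurableT_comp (@measurable_snd _ _ bool (bool * V)%type) m2.
apply: measurable_fun_pair; last exact: (measurableT_comp measurable_snd m22).
apply: measurable_fun_pair; last exact: (measurableT_comp measurable_fst m22).
apply: measurable_fun_pair; last exact: measurable_fun_pair.
by apply: measurable_fun_pair; apply: measurable_fun_pair;
  [exact: (measurableT_comp measurable_fst m11)|exact: (measurableT_comp measurable_fst m12)
  |exact: (measurableT_comp measurable_snd m11)|exact: (measurableT_comp measurable_snd m12)].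
Qed.

(** The pair [(Z, V)] has the observed law, and the types and both arms are
    drawn given [V] only. *)
Let latent_law : exists Q : {finite_measure set (latent V R) -> \bar R},
  forall t (F : latent V R -> \bar R), measurable_fun setT F -> (forall w, 0 <= F w) ->
    (forall s u, F (latent_of (s, u)) = F (latent_of ((at_ t s, at_ t s), u))) ->
    \int[Q]_w F w = \int[P]_o
      (\int[m]_s (F (latent_of ((s, s), (true, obsZV o))) * (b t (s, (true, obsZV o)))%:E) +
       \int[m]_s (F (latent_of ((s, s), (false, obsZV o))) * (b t (s, (false, obsZV o)))%:E)).
Proof.
have [rho [rhoE rhoI]] := law_of P (@measurable_obsZV R _ V).
have [mu fub] := finite_prod_exists (@counting_bool R) rho.
have muE (g : U -> \bar R) : measurable_fun setT g -> (forall u, 0 <= g u) ->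
    \int[mu]_u g u = \int[P]_o (g (true, obsZV o) + g (false, obsZV o)).
  move=> mg g0; rewrite (fub _ mg g0).2.
  have sumE y : \int[@counting_bool R]_x g (x, y) = g (true, y) + g (false, y).
    by rewrite integral_counting_bool.
  under eq_integral do rewrite sumE.
  by rewrite rhoI//; apply: emeasurable_funD; exact: (measurable_fun_pair2 _ mg).
have Woo : \int[mu]_u (W u)%:E < +oo.
  rewrite muE.
  - rewrite (eq_integral (cst 1)); last first.
      by move=> o _; rewrite /W /= -EFinD subrK.
    by rewrite integral_cst// mul1e ltey_eq fin_num_measure.
  - exact/measurable_EFinP.
  - move=> u; rewrite lee_fin /W; have /andP[l0 l1] := lam01.
    have /andP[k0 k1] := kap01 u.2.2.
    by case: ifP => _; [rewrite subr_ge0 mulr_ile1|rewrite mulr_ge0].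
have [Gam GamE] := coupling mb b0 mW bW Woo.
have c0 (x : (S * S) * U) : 0 <= (cst 1 x : \bar R) by [].
have coo : \int[Gam]_x (cst 1 x : \bar R) < +oo.
  by rewrite integral_cst// mul1e ltey_eq fin_num_measure.
have [Q QE] := weighted_law (@measurable_cst _ _ _ _ setT (1%E : \bar R)) c0 coo mlatent_of.
exists Q => t F mF F0 Ft; rewrite QE//.
have mFl : measurable_fun setT (fun x => F (latent_of x)) by exact: measurableT_comp.
transitivity (\int[Gam]_x F (latent_of x)).
  by apply: eq_integral => x _; rewrite mule1.
rewrite (GamE t)// muE//.
- pose h (x : S * U) := F (latent_of ((x.1, x.1), x.2)) * (b t x)%:E.
  apply: (measurable_fun_fubini_tonelli_G (m1 := m) h).
    apply: emeasurable_funM; last exact/measurable_EFinP.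
    apply: (measurableT_comp mFl); apply: measurable_fun_pair => //.
    exact: measurable_fun_pair.
  by move=> x; rewrite mule_ge0// lee_fin.
- by move=> u; apply: integral_ge0 => s _; rewrite mule_ge0// lee_fin.
Qed.

Section Realization.
Variable Q : probability (latent V R) R.
Hypothesis QM : forall t (F : latent V R -> \bar R), measurable_fun setT F ->
  (forall w, 0 <= F w) ->
  (forall s u, F (latent_of (s, u)) = F (latent_of ((at_ t s, at_ t s), u))) ->
  \int[Q]_w F w = \int[P]_o
    (\int[m]_s (F (latent_of ((s, s), (true, obsZV o))) * (b t (s, (true, obsZV o)))%:E) +
     \int[m]_s (F (latent_of ((s, s), (false, obsZV o))) * (b t (s, (false, obsZV o)))%:E)).

Let X t (w : latent V R) := (latT t w, latY t w, latTstar false w, latTstar true w).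

Let mX t : measurable_fun setT (X t).
Proof.
by repeat apply: measurable_fun_pair; [exact: measurable_latT|exact: measurable_latY|
  exact: measurable_latTstar|exact: measurable_latTstar].
Qed.

(** The variables of one arm, as they enter condition (A), of a unit of type
    [c]. *)
Let Xs (c : bool) (s : S) : bool * R * bool * bool := (s.2, s.1, false, c).

Let mXs c : measurable_fun setT (Xs c).
Proof. by repeat apply: measurable_fun_pair. Qed.

(** The conditional probability given [V] that the type is [c] and that the
    latent variables of the arm [t] are in [B]. As [b] is the same for both
    values of [Z], the index may take [true] for it. *)
Let kB t (B : set (bool * R * bool * bool)) (c : bool) (v : V) : \bar R :=
  \int[m]_s ((\1_B (Xs c s))%:E * (b t (s, (c, (true, v))))%:E).

Let mkB_integrand t B c : measurable B ->
  measurable_fun setT (fun x : S * V =>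
    (\1_B (Xs c x.1))%:E * (b t (x.1, (c, (true, x.2))))%:E).
Proof.
move=> mB; apply: emeasurable_funM.
  apply: (measurableT_comp (measurable_indicE mB)).
  exact: (measurableT_comp (mXs c) measurable_fst).
apply/measurable_EFinP; apply: (measurableT_comp (mb t)).
by repeat apply: measurable_fun_pair.
Qed.

Let kB_integrand_ge0 t B c (x : S * V) :
  0 <= (\1_B (Xs c x.1))%:E * (b t (x.1, (c, (true, x.2))))%:E.
Proof. by rewrite mule_ge0// lee_fin. Qed.

Let mkB t B c : measurable B -> measurable_fun setT (kB t B c).
Proof.
move=> mB; exact: (measurable_fun_fubini_tonelli_G (m1 := m) _
  (mkB_integrand t c mB) (kB_integrand_ge0 t B c)).
Qed.

Let kB_ge0 t B c v : 0 <= kB t B c v.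
Proof. by apply: integral_ge0 => s _; exact: (kB_integrand_ge0 t B c (s, v)). Qed.

(** Given [V], the latent variables of the arm [t] have been drawn without
    regard to [Z]. *)
Let integral_arm_latent t B (G : bool * V -> \bar R) : measurable B ->
  measurable_fun setT G -> (forall u, 0 <= G u) ->
  \int[Q]_w (G (latZ w, latV w) * (\1_B (X t w))%:E) =
  \int[P]_o (G (obsZV o) * (kB t B true (obsV o) + kB t B false (obsV o))).
Proof.
move=> mB mG G0; rewrite (QM (t := t)).
- apply: eq_integral => o _; rewrite ge0_muleDr ?kB_ge0//.
  have pull c : \int[m]_s (G (latZ (latent_of (s, s, (c, obsZV o))),
        latV (latent_of (s, s, (c, obsZV o)))) *
      (\1_B (X t (latent_of (s, s, (c, obsZV o)))))%:E * (b t (s, (c, obsZV o)))%:E) =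
      G (obsZV o) * kB t B c (obsV o).
    rewrite -ge0_integralZl//.
    - apply: eq_integral => s _; rewrite -muleA; congr (_ * (_ * _)).
      by rewrite /X /Xs; case: (t).
    - exact: (measurable_fun_pair1 (obsV o) (mkB_integrand t c mB)).
    - by move=> s _; exact: (kB_integrand_ge0 t B c (s, obsV o)).
  by rewrite !pull.
- apply: emeasurable_funM.
    apply: (measurableT_comp mG).
    exact: measurable_fun_pair measurable_latZ measurable_latV.
  exact: (measurableT_comp (measurable_indicE mB) (mX t)).
- by move=> w; rewrite mule_ge0.
- by move=> s u; congr (_ * (\1_B _)%:E); rewrite /X; case: (t).
Qed.

Let resample t z B D : measurable B -> measurable D ->
  Q (latZ @^-1` [set z] `&` (X t @^-1` B `&` latV @^-1` D)) =
  \int[Q]_(w in X t @^-1` B `&` latV @^-1` D) (bernoulli_mass (pr (latV w)) z)%:E.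
Proof.
move=> mB mD.
have mZz : measurable (@latZ _ V R @^-1` [set z]).
  exact: measurable_preimage measurable_latZ _.
have mXB : measurable (X t @^-1` B) by exact: measurable_preimage.
have mVD : measurable (@latV _ V R @^-1` D).
  exact: measurable_preimage measurable_latV mD.
have mk : measurable_fun setT (fun v => kB t B true v + kB t B false v).
  by apply: emeasurable_funD; exact: mkB.
have k0 v : 0 <= kB t B true v + kB t B false v by rewrite adde_ge0// kB_ge0.
pose G1 (u : bool * V) : \bar R := (\1_[set z] u.1)%:E * (\1_D u.2)%:E.
pose G2 (u : bool * V) : \bar R := (bernoulli_mass (pr u.2) z)%:E * (\1_D u.2)%:E.
have mD2 : measurable_fun setT (fun u : bool * V => (\1_D u.2)%:E : \bar R).
  exact: (measurableT_comp (measurable_indicE mD) measurable_snd).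
have mG1 : measurable_fun setT G1.
  apply: emeasurable_funM => //.
  exact: (measurableT_comp (measurable_indicE (R := R) _) measurable_fst).
have mG2 : measurable_fun setT G2.
  apply: emeasurable_funM => //; apply/measurable_EFinP.
  exact: (measurableT_comp (measurable_bernoulli_mass z mpr) measurable_snd).
have G10 u : 0 <= G1 u by rewrite mule_ge0.
have G20 u : 0 <= G2 u by rewrite mule_ge0// lee_fin ltW// bernoulli_mass_gt0.
transitivity (\int[Q]_w (G1 (latZ w, latV w) * (\1_B (X t w))%:E)).
  rewrite measure_integral_indic; last by apply: measurableI => //; exact: measurableI.
  apply: eq_integral => w _; rewrite /G1 -!EFinM; congr EFin.
  by rewrite !indicI /= -mulrA; congr (_ * _)%R; rewrite mulrC.
rewrite integral_arm_latent//.
transitivity (\int[Q]_w (G2 (latZ w, latV w) * (\1_B (X t w))%:E)); last first.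
  rewrite -[RHS]integral_indicM; apply: eq_integral => w _.
  by rewrite indicI /= EFinM muleC muleA -muleA (muleC (bernoulli_mass _ _)%:E) muleA.
rewrite integral_arm_latent//.
have E := propensity_integral measurable_obsV measurable_obsZ mpr pr01 prE z
  (emeasurable_funM (measurable_indicE mD) mk)
  (fun v => mule_ge0 (indicE_ge0 D v) (k0 v)).
transitivity (\int[P]_o ((\1_D (obsV o))%:E *
    (kB t B true (obsV o) + kB t B false (obsV o)) *
    (\1_(obsZ @^-1` [set z]) o)%:E)).
  by apply: eq_integral => o _; rewrite [RHS]muleC muleA.
by rewrite E; apply: eq_integral => o _; rewrite [LHS]muleC muleA.
Qed.

Let prQ z D : measurable D -> Q (latZ @^-1` [set z] `&` latV @^-1` D) =
  \int[Q]_(w in latV @^-1` D) (bernoulli_mass (pr (latV w)) z)%:E.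
Proof.
by move=> mD; have := resample true z measurableT mD; rewrite preimage_setT !setTI.
Qed.

Let never_treated : {ae Q, forall w, ~~ latTstar false w}.
Proof.
have mN : measurable (takers (R := R) (V := V) false) by exact: measurable_takers.
exists (takers false); split => //.
  rewrite measure_integral_indic// (QM (t := true))//; last exact: measurable_indicE.
  apply: integral0_eq => o _.
  rewrite !integral0_eq ?adde0// => s _; rewrite indicE memNset ?mul0e//=.
by move=> w /= /negP/negPn.
Qed.

Lemma realization_condition_A : condition_A Q.
Proof.
split.
- move=> t.
  exact: (resample_cond_indep measurable_latV measurable_latZ (mX t) mpr pr01 (resample t)).
- by move: never_treated; apply: filterS => w; case: (latTstar false w).
exact: (propensity_overlap measurable_latV measurable_latZ mpr pr01 prQ).
Qed.

(** A null set of outcomes gives a null set of pairs for the measure against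
    which all the arms have densities. *)
Lemma realization_dominated : outcomes_dominated muY Q.
Proof.
move=> t; apply/null_content_dominatesP => N mN N0.
rewrite /pushforward.
have mYN : measurable (@latY _ V R t @^-1` N).
  exact: measurable_preimage (measurable_latY t) mN.
rewrite (measure_integral_indic Q mYN) (QM (t := t)); last 3 first.
- exact: measurable_indicE.
- by move=> w.
- by move=> s u; rewrite !indicE; congr (_%:R%:E); case: (t).
have mNS : measurable (N `*` [set: bool]) by exact: measurableX.
have NS0 : m (N `*` [set: bool]) = 0.
  by rewrite [LHS]product_measure1E//= N0 mul0e.
apply: integral0_eq => o _.
have zero c : \int[m]_s ((\1_(latY t @^-1` N) (latent_of (s, s, (c, obsZV o))))%:E *
    (b t (s, (c, obsZV o)))%:E) = 0.
  transitivity (\int[m]_s ((\1_(N `*` [set: bool]) s)%:E * (b t (s, (c, obsZV o)))%:E)).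
    apply: eq_integral => s _; congr (_%:E * _); rewrite !indicE; congr ((nat_of_bool _)%:R).
    by apply/idP/idP; rewrite !inE /preimage /latY/=; case: (t) => //= -[].
  rewrite integral_indicM null_set_integral//.
  apply: measurable_funTS; apply/measurable_EFinP.
  exact: (measurable_fun_pair1 (c, obsZV o) (mb t)).
by rewrite !zero adde0.
Qed.

Lemma realization_compliers : Q compliers = 1 - lam%:E * mean_overlap muY P q.
Proof.
have mC := measurable_compliers (R := R) (V := V).
rewrite measure_integral_indic// (QM (t := true))//; last exact: measurable_indicE.
have mov : measurable_fun setT (fun o : obs V R => overlap_mass muY q (obsV o)).
  exact: (measurableT_comp (measurable_overlap_mass model) measurable_obsV).
have fin := mean_overlap_fin model.
have iov : P.-integrable setT (fun o : obs V R => overlap_mass muY q (obsV o)).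
  apply/integrableP; split => //.
  under eq_integral do rewrite gee0_abs ?(overlap_mass_ge0 model)//.
  by move: fin; rewrite ge0_fin_numE ?(mean_overlap_ge0 model).
transitivity (\int[P]_o (1 - lam%:E * overlap_mass muY q (obsV o))).
  apply: eq_integral => o _.
  rewrite [X in _ + X]integral0_eq ?adde0; last first.
    by move=> s _; rewrite indicE memNset ?mul0e.
  rewrite (eq_integral (fun s => (b true (s, (true, obsZV o)))%:E)); last first.
    by move=> s _; rewrite indicE mem_set// mul1e.
  by rewrite bW /W /= EFinB EFinM kapE.
rewrite integralB//; last 2 first.
- exact: finite_measure_integrable_cst.
- exact: integrableZl.
by rewrite integralZl// integral_cst// mul1e [X in X - _]probability_setT.
Qed.

(** The observed arm is the one of index [T w], and the integrals over the two
    values of [T w] each involve a single arm. For either value of [Z] the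
    compliers contribute [q_z - r] and the never-takers [r]. *)
Lemma realization_induces : induces Q P.
Proof.
move=> A mA.
have mOA : measurable (@observe _ V R @^-1` A).
  exact: measurable_preimage measurable_observe mA.
pose T (w : latent V R) := if latZ w then latTstar true w else latTstar false w.
have mT : measurable_fun setT T.
  by apply: measurable_fun_ifT; [exact: measurable_latZ|exact: measurable_latTstar|
    exact: measurable_latTstar].
have mTt t : measurable (T @^-1` [set t]) by exact: measurable_preimage.
pose F t (w : latent V R) : \bar R :=
  (\1_(observe @^-1` A) w)%:E * (\1_(T @^-1` [set t]) w)%:E.
have mF t : measurable_fun setT (F t).
  by apply: emeasurable_funM; exact: measurable_indicE.
have F0 t w : 0 <= F t w by rewrite mule_ge0.
have mix : \int[Q]_w (\1_(observe @^-1` A) w)%:E =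
    \int[Q]_w F true w + \int[Q]_w F false w.
  rewrite -ge0_integralD//; apply: eq_integral => w _.
  rewrite /F -ge0_muleDr// -[LHS]mule1; congr (_ * _).
  rewrite !indicE -EFinD; have inT t : (w \in T @^-1` [set t]) = (T w == t).
    by apply/idP/eqP; rewrite inE.
  by rewrite !inT; case: (T w); rewrite /= ?addr0 ?add0r.
rewrite (measure_integral_indic Q mOA) mix.
have Fdep t s u : F t (latent_of (s, u)) = F t (latent_of ((at_ t s, at_ t s), u)).
  case: s u => s0 s1 [c [z v]].
  have inT x : (latent_of (x, (c, (z, v))) \in T @^-1` [set t]) = ((z && c) == t).
    by apply/idP/eqP; rewrite inE /preimage /T /mkset /=; case: (z).
  rewrite /F !indicE !inT; case: eqP => [zc|_]; last by rewrite !mule0.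
  congr ((nat_of_bool _)%:R%:E * _); apply/idP/idP; rewrite !inE /preimage /mkset /observe;
    rewrite /latent_of /latTstar /latZ /latY /latT /latV /=;
    by move: zc; case: (z); case: (c); case: (t) => //=.
rewrite (QM (mF true) (F0 true) (Fdep true)) (QM (mF false) (F0 false) (Fdep false)).
have mI t c : measurable_fun setT (fun o : obs V R =>
    \int[m]_s (F t (latent_of ((s, s), (c, obsZV o))) * (b t (s, (c, obsZV o)))%:E)).
  pose h (x : S * (bool * V)) :=
    F t (latent_of ((x.1, x.1), (c, x.2))) * (b t (x.1, (c, x.2)))%:E.
  have mh : measurable_fun setT h.
    apply: emeasurable_funM.
      apply: (measurableT_comp (mF t)); apply: (measurableT_comp mlatent_of).
      by apply: measurable_fun_pair; apply: measurable_fun_pair.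
    apply/measurable_EFinP; apply: (measurableT_comp (mb t)).
    by apply: measurable_fun_pair => //; exact: measurable_fun_pair.
  have h0 x : 0 <= h x by rewrite mule_ge0// lee_fin.
  exact: (measurableT_comp (measurable_fun_fubini_tonelli_G (m1 := m) _ mh h0)
    measurable_obsZV).
have I0 t c o : 0 <= \int[m]_s
    (F t (latent_of ((s, s), (c, obsZV o))) * (b t (s, (c, obsZV o)))%:E).
  by apply: integral_ge0 => s _; rewrite mule_ge0// lee_fin.
rewrite -ge0_integralD//; last 4 first.
- by move=> o _; rewrite adde_ge0.
- exact: emeasurable_funD.
- by move=> o _; rewrite adde_ge0.
- exact: emeasurable_funD.
pose G (x : S * (bool * V)) : \bar R := (\1_A ((x.1, x.2.1), x.2.2))%:E.
have mG : measurable_fun setT G.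
  apply: (measurableT_comp (measurable_indicE mA)); apply: measurable_fun_pair.
    by apply: measurable_fun_pair => //; exact: (measurableT_comp measurable_fst measurable_snd).
  exact: (measurableT_comp measurable_snd measurable_snd).
have G0 x : 0 <= G x by exact: indicE_ge0.
transitivity (\int[P]_o G (obsYT o, obsZV o)); last first.
  rewrite [RHS]measure_integral_indic//.
  by apply: eq_integral => -[[yt z] v] _.
rewrite (cond_density_integral (mu := m) measurable_obsZV measurable_obsYT q_density mG G0).
apply: eq_integral => o _; move: (obsZV o) => [z v] {o}.
pose J t c := \int[m]_s (G (s, (z, v)) * (b t (s, (c, (z, v))))%:E).
have IE t c : \int[m]_s (F t (latent_of ((s, s), (c, (z, v)))) *
    (b t (s, (c, (z, v))))%:E) = (if (z && c) == t then J t c else 0).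
  have inT s : (latent_of ((s, s), (c, (z, v))) \in T @^-1` [set t]) = ((z && c) == t).
    by apply/idP/eqP; rewrite inE /preimage /T /mkset /=; case: (z).
  have inA s : (latent_of ((s, s), (c, (z, v))) \in observe @^-1` A) =
      ((s, z, v) \in A).
    apply/idP/idP; rewrite !inE /preimage /mkset /observe;
      by rewrite /latent_of /latTstar /latZ /latY /latT /latV /=; case: (z);
        case: (c); case: s => y t' /=.
  case: ifP => zc; last first.
    by apply: integral0_eq => s _; rewrite /F [\1_(T @^-1` _) _]indicE inT zc mule0 mul0e.
  apply: eq_integral => s _; rewrite /F [\1_(T @^-1` _) _]indicE inT zc mule1.
  by congr (_ * _); rewrite /G !indicE inA.
have mGzv : measurable_fun setT (fun s => G (s, (z, v))).
  exact: (measurable_fun_pair1 (z, v) mG).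
have Jsum : J z true + J false false = \int[m]_s (G (s, (z, v)) * (q (s, (z, v)))%:E).
  rewrite -ge0_integralD//.
  - apply: eq_integral => s _; rewrite -ge0_muleDr ?lee_fin//.
    by rewrite -EFinD /b /= subrK.
  - by move=> s _; rewrite mule_ge0// lee_fin.
  - apply: emeasurable_funM => //; apply/measurable_EFinP.
    exact: (measurable_fun_pair1 (true, (z, v)) (mb z)).
  - by move=> s _; rewrite mule_ge0// lee_fin.
  - apply: emeasurable_funM => //; apply/measurable_EFinP.
    exact: (measurable_fun_pair1 (false, (z, v)) (mb false)).
rewrite !IE -Jsum; case: (z) => /=; by rewrite ?(adde0, add0e).
Qed.

End Realization.

Lemma realization : exists Q : probability (latent V R) R,
  [/\ condition_A Q, outcomes_dominated muY Q, induces Q P &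
    Q compliers = 1 - lam%:E * mean_overlap muY P q].
Proof.
have [Q0 QM] := latent_law.
have Q1 : Q0 setT = 1.
  rewrite measure_integral_indic// (QM true)//; last exact: measurable_indicE.
  have one c o : \int[m]_s ((\1_setT (latent_of (s, s, (c, obsZV o))))%:E *
      (b true (s, (c, obsZV o)))%:E) = (W (c, obsZV o))%:E.
    by rewrite -(bW true); apply: eq_integral => s _; rewrite indicT mul1e.
  under eq_integral do rewrite !one.
  rewrite (eq_integral (cst 1)); last by move=> o _; rewrite /W /= -EFinD subrK.
  by rewrite integral_cst// mul1e; exact: probability_setT.
pose Q : probability (latent V R) R :=
  HB.pack (FiniteMeasure.sort Q0)
    (Measure_isProbability.Build _ _ _ Q0 Q1).
exists Q; split.
- exact: (realization_condition_A (Q := Q) QM).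
- exact: (realization_dominated (Q := Q) QM).
- exact: (realization_induces (Q := Q) QM).
- exact: (realization_compliers (Q := Q) QM).
Qed.

End Sufficiency.

(** * The outcome density among the compliers *)

Section Complier_density.
Local Open Scope ereal_scope.
Context {R : realType} {dV : measure_display} {V : measurableType dV}.
Variables (muY : {finite_measure set R -> \bar R})
  (Q : probability (latent V R) R).
Hypotheses (domQ : outcomes_dominated muY Q) (C0 : Q compliers != 0)
  (intY : forall t, Q.-integrable compliers (fun w => (latY t w)%:E)).

Let c := fine (Q compliers).

Let cE : c%:E = Q compliers.
Proof. by rewrite fineK// fin_num_measure//; exact: measurable_compliers. Qed.

Let c_gt0 : (0 < c)%R.
Proof. by rewrite -lte_fin cE lt_def C0 measure_ge0. Qed.

(** The law of the outcome among the compliers is dominated by [muY]; its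
    Radon-Nikodym derivative is the density. *)
Lemma complier_density t : exists f, is_density muY f /\
  \int[muY]_y (y * f y)%:E = c^-1%:E * \int[Q]_(w in compliers) (latY t w)%:E.
Proof.
have mC := measurable_compliers (R := R) (V := V).
pose g (w : latent V R) : \bar R := (\1_compliers w)%:E * c^-1%:E.
have mg : measurable_fun setT g by apply: emeasurable_funM => //; exact: measurable_indicE.
have ci0 : (0 <= c^-1)%R by rewrite invr_ge0 ltW.
have g0 w : 0 <= g w by rewrite mule_ge0.
have intg (h : latent V R -> \bar R) : measurable_fun setT h -> (forall w, 0 <= h w) ->
    \int[Q]_w (h w * g w) = c^-1%:E * \int[Q]_(w in compliers) h w.
  move=> mh h0; rewrite -(integral_indicM Q compliers h) -ge0_integralZl//.
  - by apply: eq_integral => w _; rewrite /g muleA muleC (muleC (h w)).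
  - by apply: emeasurable_funM => //; exact: measurable_indicE.
  - by move=> w _; rewrite mule_ge0.
have Qc : \int[Q]_(w in compliers) (cst 1 w : \bar R) = c%:E.
  by rewrite integral_cst// mul1e; exact: esym cE.
have gmass : \int[Q]_w g w = 1.
  rewrite (eq_integral (fun w => (cst 1 w : \bar R) * g w)); last first.
    by move=> w _; rewrite mul1e.
  by rewrite intg// Qc -EFinM mulVf// gt_eqF.
have goo : \int[Q]_w g w < +oo by rewrite gmass ltry.
have [kap kapE] := weighted_law mg g0 goo (measurable_latY (V := V) t).
have dom : kap `<< muY.
  apply/null_content_dominatesP => N mN N0.
  have QN : Q (latY t @^-1` N) = 0.
    by move/null_content_dominatesP : (domQ t); exact.
  rewrite measure_integral_indic// kapE//; last exact: measurable_indicE.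
  rewrite (integral_indicM Q (latY t @^-1` N)) null_set_integral//.
    exact: measurable_preimage (measurable_latY t) mN.
  exact: measurable_funTS.
pose f := Radon_Nikodym_SigmaFinite.f kap muY.
have f0 y : 0 <= f y by exact: Radon_Nikodym_SigmaFinite.f_ge0.
have ffin y : f y \is a fin_num by exact: Radon_Nikodym_SigmaFinite.f_fin_num.
have mf : measurable_fun setT f.
  exact: measurable_int (Radon_Nikodym_SigmaFinite.f_integrable dom).
have cov (h : R -> \bar R) : measurable_fun setT h -> (forall y, 0 <= h y) ->
    \int[muY]_y (h y * f y) = c^-1%:E * \int[Q]_(w in compliers) h (latY t w).
  move=> mh h0; rewrite Radon_Nikodym_SigmaFinite.change_of_variables// kapE//.
  rewrite (intg (fun w => h (latY t w)))//.
  by apply: (measurableT_comp mh); exact: measurable_latY.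
have mfine : measurable_fun setT (fine \o f) by exact: measurableT_comp.
pose yf := fun y : R => (y * fine (f y))%:E : \bar R.
have myf : measurable_fun setT yf.
  by apply/measurable_EFinP; exact: measurable_funM.
have absE : \int[muY]_y `|yf y| =
    c^-1%:E * \int[Q]_(w in compliers) `|(latY t w)%:E|.
  rewrite -(cov (fun y => `|y|%:E))//.
    by apply: eq_integral => y _; rewrite /yf EFinM fineK// abseM (gee0_abs (f0 y)).
  by apply/measurable_EFinP; apply: normr_measurable.
have posE : yf^\+ = (fun y => (Num.max y 0)%:E * f y).
  apply/funext => y; rewrite funeposE /yf EFinM fineK// EFin_max.
  by rewrite maxe_pMl// mul0e.
have negE : yf^\- = (fun y => (Num.max (- y) 0)%:E * f y).
  apply/funext => y; rewrite funenegE /yf EFinM fineK// EFin_max EFinN.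
  by rewrite maxe_pMl// mul0e mulNe.
have iyf : muY.-integrable setT yf.
  apply/integrableP; split => //; rewrite absE.
  have /integrableP[_ Yoo] := intY t.
  by apply: lte_mul_pinfty; rewrite ?lee_fin.
exists (fine \o f); split.
  split => //.
  - by move=> y /=; rewrite fine_ge0.
  - transitivity (\int[muY]_y (cst 1 y * f y)).
      by apply: eq_integral => y _; rewrite /= fineK// mul1e.
    by rewrite (cov (cst 1))// Qc -EFinM mulVf// gt_eqF.
rewrite -/yf integralE posE negE [in RHS]integralE.
rewrite (cov (fun y => (Num.max y 0)%:E))//; last 2 first.
- by apply/measurable_EFinP; exact: measurable_maxr.
- by move=> y; rewrite lee_fin le_max lexx orbT.
rewrite (cov (fun y => (Num.max (- y) 0)%:E))//; last 2 first.
- by apply/measurable_EFinP; apply: measurable_maxr => //; exact: measurableT_comp.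
- by move=> y; rewrite lee_fin le_max lexx orbT.
rewrite [RHS]muleBr//; last first.
  apply: fin_num_adde_defl; rewrite fin_numN.
  rewrite ge0_fin_numE; last by apply: integral_ge0 => w _; exact: funeneg_ge0.
  by apply: integral_funeneg_lt_pinfty; [exact: mC|exact: intY].
congr (_ * _ - _ * _); apply: eq_integral => w _.
  by rewrite funeposE EFin_max.
by rewrite funenegE EFin_max EFinN.
Qed.

(** The effect is the difference of the means of the two complier densities. *)
Lemma complier_effect_Theta theta :
  theta%:E = c^-1%:E * \int[Q]_(w in compliers) (latY true w - latY false w)%:E ->
  Theta muY theta.
Proof.
have mC := measurable_compliers (R := R) (V := V).
have [f1 [df1 E1]] := complier_density true.
have [f0 [df0 E0]] := complier_density false.
move=> thetaE; exists f0, f1; split => //.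
apply: EFin_inj; rewrite EFinB /Rintegral.
have [_ _ _ i1] := df1; have [_ _ _ i0] := df0.
rewrite !fineK; [|exact: integrable_fin_num|exact: integrable_fin_num].
rewrite E1 E0 -muleBr//; last first.
  by apply: fin_num_adde_defr; apply: integrable_fin_num.
rewrite -integralB// thetaE; congr (_ * _).
Qed.

End Complier_density.

(** * The identified set *)

Section Identified_set.
Context {R : realType} {dV : measure_display} {V : measurableType dV}.
Variables (muY : {finite_measure set R -> \bar R}) (P : probability (obs V R) R).
Hypothesis admP : admissible_law muY P.

Let TV := mean_TV_YT muY P.
Let D := mean_DeltaEY P.

(** A latent law matters only through the mass [c] of its compliers. The bounds
    on [c] are [compliers_lower_bound] and the realization with the share
    [lam] that gives this [c]. *)
Lemma ThetaI_complier_mass : [/\ 0 <= TV, TV <= 1 &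
  forall theta, ThetaI muY P theta <->
    exists c, [/\ TV <= c, c <= 1 &
      (c != 0 /\ theta = D / c) \/ (c = 0 /\ Theta muY theta)]].
Proof.
have [ov dom _] := admP.
have [pr [mpr pr01 prE]] := propensity measurable_obsV measurable_obsZ ov.
have [q [q_density q1 qE]] := normalized_cond_density admP.
have model : propensity_density muY P pr q by [].
have fin := mean_overlap_fin model.
set K := fine (mean_overlap muY P q).
have KE : mean_overlap muY P q = K%:E by rewrite fineK.
have TVE : TV = 1 - K by exact: mean_TV_overlap model qE.
have K0 : 0 <= K by rewrite fine_ge0// (mean_overlap_ge0 model).
have K1 : K <= 1 by rewrite -lee_fin -KE; exact: mean_overlap_le1 model.
split; [lra|lra|move=> theta; split].
- move=> [theta_Theta [Q [condA domQ indQ late]]].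
  have QE : Q compliers = (fine (Q compliers))%:E.
    by rewrite fineK// fin_num_measure//; exact: measurable_compliers.
  exists (fine (Q compliers)); split.
  + have := compliers_lower_bound model condA indQ.
    by rewrite KE QE -EFinD lee_fin TVE; lra.
  + by rewrite -lee_fin -QE; apply: probability_le1; exact: measurable_compliers.
  + case: late => [[C0]|[C0 _]]; last by right; rewrite C0.
    rewrite (complier_effect model condA indQ admP) -EFinM => -[->].
    left; split; last by rewrite mulrC.
    by apply: contra_neq C0 => c0; rewrite QE c0.
move=> [c [TVc c1 effect]].
(* If [K] is zero then [c] is one, and [lam] is zero as a division by zero. *)
pose lam := (1 - c) / K.
have lamK : lam * K = 1 - c.
  by have [K00|K00] := eqVneq K 0; [rewrite /lam K00; lra|rewrite /lam divfK].
have lam01 : 0 <= lam <= 1.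
  have [K00|K00] := eqVneq K 0; first by rewrite /lam K00 invr0 mulr0 lexx ler01.
  have Kpos : 0 < K by rewrite lt_def K00.
  by rewrite /lam divr_ge0 ?subr_ge0//= ler_pdivrMr// mul1r; lra.
have [Q [condA domQ indQ QC]] := realization model lam01.
have QcE : Q compliers = c%:E.
  by rewrite QC KE -EFinM lamK -EFinB; congr EFin; lra.
case: effect => [[c0 thetaE]|[c0 theta_Theta]]; last first.
  by split => //; exists Q; split => //; right; rewrite QcE c0.
have QC0 : Q compliers != 0%E by rewrite QcE eqe.
have late : theta%:E = ((fine (Q compliers))^-1%:E *
    \int[Q]_(w in compliers) (latY true w - latY false w)%:E)%E.
  by rewrite (complier_effect model condA indQ admP) -EFinM QcE thetaE /= mulrC.
split; last by exists Q; split => //; left.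
apply: (complier_effect_Theta domQ QC0) late => t.
exact: (complier_outcome_integrable model condA indQ admP t).
Qed.

End Identified_set.

Theorem theorem7 (R : realType) (dV : measure_display) (V : measurableType dV)
    (muY : {finite_measure set R -> \bar R}) (P : probability (obs V R) R)
    (admP : admissible_law muY P) :
  ThetaI muY P =
    if mean_TV_YT muY P == 0 then Theta muY
    else if 0 < mean_DeltaEY P then
      `[mean_DeltaEY P, mean_DeltaEY P / mean_TV_YT muY P]%classic
    else if mean_DeltaEY P == 0 then [set 0]
    else `[mean_DeltaEY P / mean_TV_YT muY P, mean_DeltaEY P]%classic.
Proof.
have [TV0 TV1 char] := ThetaI_complier_mass admP.
move: TV0 TV1 char; set TV := mean_TV_YT muY P; set D := mean_DeltaEY P.
move=> TV0 TV1 char; apply/seteqP.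
have [TVeq0|TVneq0] := eqVneq TV 0.
  split => theta; first by case.
  by move=> th; apply/char; exists 0; rewrite TVeq0 lexx ler01; split => //; right.
have TVpos : 0 < TV by rewrite lt_def TVneq0.
have char' theta : ThetaI muY P theta <->
    exists c, [/\ TV <= c, c <= 1 & theta * c = D].
  rewrite char; split=> -[c [TVc c1]].
    move=> [[c0 ->]|[c0 _]]; last by move: TVc; rewrite c0 leNgt TVpos.
    by exists c; rewrite divfK.
  move=> E; exists c; split => //; left.
  have c0 : c != 0 by rewrite gt_eqF// (lt_le_trans TVpos).
  by rewrite -E mulfK.
(* The solutions of [theta * c = D] for [c] between [TV] and one. *)
have [D0|D0] := ltP 0 D; last first.
  have [Deq0|Dneq0] := eqVneq D 0.
    split => theta /=; rewrite char'.
      move=> [c [TVc c1 /eqP]]; rewrite Deq0 mulf_eq0 => /orP[/eqP//|/eqP c0].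
      by move: TVc; rewrite c0 leNgt TVpos.
    by move=> ->; exists 1; split => //; rewrite mul0r Deq0.
  have Dneg : D < 0 by rewrite lt_def eq_sym Dneq0.
  split => theta /=; rewrite char' in_itv /=.
    move=> [c [TVc c1 E]]; have c0 : 0 < c by exact: lt_le_trans TVc.
    have th0 : theta < 0 by rewrite -(pmulr_llt0 _ c0) E.
    by rewrite ler_pdivrMr// -E; apply/andP; split; nra.
  move=> /andP[]; rewrite ler_pdivrMr// => h1 h2.
  have th0 : theta < 0 by exact: le_lt_trans h2 Dneg.
  exists (D / theta); split.
  - by rewrite ler_ndivlMr// mulrC.
  - by rewrite ler_ndivrMr// mul1r.
  - by rewrite mulrC divfK// lt_eqF.
split => theta /=; rewrite char' in_itv /=.
  move=> [c [TVc c1 E]]; have c0 : 0 < c by exact: lt_le_trans TVc.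
  have th0 : 0 < theta by rewrite -(pmulr_lgt0 _ c0) E.
  by rewrite ler_pdivlMr// -E; apply/andP; split; nra.
move=> /andP[]; rewrite ler_pdivlMr// => h1 h2.
have th0 : 0 < theta by exact: lt_le_trans D0 h1.
exists (D / theta); split.
- by rewrite ler_pdivlMr// mulrC.
- by rewrite ler_pdivrMr// mul1r.
- by rewrite mulrC divfK// gt_eqF.
Qed.
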